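(* Let $\Omega$ be a compact topological measurable space with a Borel probability measure $\mu$, let $k\colon\Omega\times\Omega\to\mathbb{C}$ be a Mercer kernel with reproducing kernel Hilbert space $H(k)$, and let $n<\dim(H(k))$. With $\sigma_j,\psi_j,\omega_n$ as in the context, there exist $N\le n^2+1$, points $x^1,\dots,x^N\in\Omega$ and weights $\lambda_1,\dots,\lambda_N\ge0$ with $\sum_{i=1}^N\lambda_i=1$ such that $$\sum_{i=1}^N\lambda_i\frac{\psi_j(x^i)\overline{\psi_l(x^i)}}{\omega_n(x^i)}=\delta_{j,l},\qquad j,l=1,\dots,n,$$ and for any such choice the linear sampling recovery operator $S^{k,\mu}_{n,N}\colon H(k)\to L_2(\mu)$, $$S^{k,\mu}_{n,N}f=\sum_{j=1}^n c_j\psi_j,\qquad c_j=\sum_{i=1}^N\frac{\lambda_i}{\omega_n(x^i)}f(x^i)\overline{\psi_j(x^i)},$$ satisfies $$\sup_{\|f\|_{H(k)}\le1}\|f-S^{k,\mu}_{n,N}f\|_{L_2(\mu)}^2\le3\sum_{j\ge n+1}\sigma_j^2\le3\,c_n(H(k),C(\Omega))^2 .$$ In addition, $S^{k,\mu}_{n,N}f$ uses $N\le n^2+1$ many function samples, and a value $S^{k,\mu}_{n,N}f(x)$ can be directly and accurately computed with less than $c\cdot n^3$ arithmetic operations, where $c>0$ is an absolute constant.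
   Context: The Mercer kernel $k$ is bounded and continuous and has the Mercer decomposition $k(x,y)=\sum_{j=1}^\infty\sigma_j^2\psi_j(x)\overline{\psi_j(y)}$ for $x,y\in\Omega$, where $(\psi_j)_j$ are the $L_2(\mu)$-orthonormal eigenfunctions of the integral operator on $L_2(\mu)$ with kernel $k$, $(\sigma_j^2)_j$ is the corresponding non-increasing sequence of non-negative eigenvalues, and $\int_\Omega k(x,x)\,\mathrm d\mu(x)=\sum_{j=1}^\infty\sigma_j^2<\infty$. The functions $\sigma_j\psi_j$ (with $\sigma_j>0$) form an orthonormal basis of $H(k)$. The density $\omega_n$ is $$\omega_n(x)=\frac12+\frac{\sum_{j=n+1}^\infty\sigma_j^2|\psi_j(x)|^2}{2\sum_{j=n+1}^\infty\sigma_j^2},$$ equivalently $\omega_n(x)=\frac12+\frac{k(x,x)-k_n(x,x)}{2\int_\Omega(k(x,x)-k_n(x,x))\,\mathrm d\mu(x)}$ with $k_n(x,x)=\sum_{j=1}^n\sigma_j^2|\psi_j(x)|^2$. The $n$th Gelfand number of the embedding $H(k)\to C(\Omega)$ ($C(\Omega)$ the continuous complex-valued functions with the sup norm) is $$c_n(H(k),C(\Omega))=\inf_{\theta,\,L}\ \sup_{\|f\|_{H(k)}\le1}\|f-\theta(L(f))\|_{C(\Omega)},$$ the infimum being over all (not necessarily linear) maps $\theta\colon\mathbb{C}^n\to C(\Omega)$ and all bounded linear maps $L\colon H(k)\to\mathbb{C}^n$. The arithmetic count refers to evaluating the defining formula of $S^{k,\mu}_{n,N}f(x)$ from the samples $f(x^i)$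 and the numbers $\lambda_i$, $\omega_n(x^i)$, $\psi_j(x^i)$, $\psi_j(x)$. *)

(* Defs.v *)
From HB Require Import structures.
From mathcomp Require Import all_boot all_order all_algebra.
From mathcomp Require Import all_classical all_reals all_analysis.
From mathcomp Require Import sesquilinear complex.
Set Implicit Arguments.
Unset Strict Implicit.
Unset Printing Implicit Defensive.
Import Order.TTheory GRing.Theory Num.Theory.
Import numFieldNormedType.Exports.
Local Open Scope classical_set_scope.
Local Open Scope ring_scope.

(* R[i] packaged as a numClosedFieldType, so that it carries the norm topology
   that MathComp-Analysis puts on the carrier of every numFieldType. *)
Definition complexField (R : realType) : numClosedFieldType := R[i]%C.

Definition RtoC (R : realType) (x : R) : complexField R := (x%:C)%C.

Definition cmod (R : realType) (z : complexField R) : R := Normc.normc z.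

Notation borelType Omega := (g_sigma_algebraType (@open Omega)).

Section integration.
Context {R : realType} {d : measure_display} {T : measurableType d}.
Variable mu : {measure set T -> \bar R}.
Implicit Types f : T -> complexField R.

Definition cmeasurable f : Prop :=
  measurable_fun [set: T] (fun x => complex.Re (f x)) /\
  measurable_fun [set: T] (fun x => complex.Im (f x)).

Definition cintegral f : complexField R :=
  (Rintegral mu [set: T] (fun x => complex.Re (f x)) +i*
   Rintegral mu [set: T] (fun x => complex.Im (f x)))%C.

Definition sqnormL2 f : \bar R := (\int[mu]_x (cmod (f x) ^+ 2)%:E)%E.

Definition inL2 f : Prop := cmeasurable f /\ (sqnormL2 f < +oo)%E.

End integration.

Section hilbert.
Variables (R : realType) (Omega : ptopologicalType).
Variable H : completeNormedModType (complexField R).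
Variable dot : {dot H for @Num.conj (complexField R)}.
Variable ev : {linear H -> (Omega -> complexField R)}.

(* n < dim H, dim H being possibly infinite *)
Definition lt_dim (n : nat) : Prop :=
  exists v : 'I_n.+1 -> H, forall a : 'I_n.+1 -> complexField R,
    \sum_(i < n.+1) a i *: v i = 0 -> forall i, a i = 0.

(* The Hilbert space H, whose elements are identified with functions on Omega
   by means of ev, is the reproducing kernel Hilbert space of k; dot is linear
   in its first argument. *)
Record is_rkhs (k : Omega -> Omega -> complexField R) : Prop := IsRKHS {
  rkhs_norm : forall f : H, dot f f = `|f| ^+ 2;
  rkhs_inj : injective ev;
  rkhs_reproducing : forall y : Omega, exists ky : H,
    ev ky = (fun x => k x y) /\ forall f : H, ev f y = dot f ky
}.

Definition supnorm (g : Omega -> complexField R) : \bar R :=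
  ereal_sup [set (cmod (g x))%:E | x in [set: Omega]].

(* Boundedness with respect to the maximum norm on C^n. *)
Definition bounded_op (n : nat) (L : {linear H -> 'cV[complexField R]_n}) : Prop :=
  exists M : complexField R, forall (f : H) (i : 'I_n), `|L f i ord0| <= M * `|f|.

(* theta is an arbitrary map from C^n to the continuous functions. *)
Definition gelfand_number (n : nat) : \bar R :=
  ereal_inf [set e | exists (theta : 'cV[complexField R]_n -> Omega -> complexField R)
                            (L : {linear H -> 'cV[complexField R]_n}),
    [/\ forall v, continuous (theta v),
        bounded_op L &
        e = ereal_sup [set supnorm (fun x => ev f x - theta (L f) x)
                      | f in [set f : H | `|f| <= 1]]]].

Definition sq_worst_case_error {d : measure_display} {T : measurableType d}
    (mu : {measure set T -> \bar R}) (emb : H -> T -> complexField R)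
    (A : H -> T -> complexField R) : \bar R :=
  ereal_sup [set sqnormL2 mu (fun x => emb f x - A f x)
            | f in [set f : H | `|f| <= 1]].

End hilbert.

Section mercer.
Variables (R : realType) (Omega : ptopologicalType).
Variable mu : probability (borelType Omega) R.
Variable k : Omega -> Omega -> complexField R.

(* Indices are shifted by one: sigma j and psi j stand for sigma_{j+1} and
   psi_{j+1}.  The psi j with sigma j = 0 are irrelevant and left arbitrary, as
   there need not be infinitely many orthonormal functions in L_2(mu). *)
Variables (sigma : nat -> R) (psi : nat -> Omega -> complexField R).

Record is_mercer : Prop := IsMercer {
  mercer_bounded : exists M : R, forall x y, cmod (k x y) <= M;
  mercer_continuous : continuous (fun p : Omega * Omega => k p.1 p.2);
  mercer_ge0 : forall j, 0 <= sigma j;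
  mercer_nonincreasing : nonincreasing_seq sigma;
  mercer_inL2 : forall j, 0 < sigma j -> inL2 mu (psi j);
  mercer_orthonormal : forall j l, 0 < sigma j -> 0 < sigma l ->
    cintegral mu (fun x => psi j x * (psi l x)^*) = (j == l)%:R;
  mercer_eigen : forall j, 0 < sigma j ->
    {ae mu, forall x, cintegral mu (fun y => k x y * psi j y)
                      = RtoC (sigma j ^+ 2) * psi j x};
  mercer_expansion : forall x y,
    series (fun j => RtoC (sigma j ^+ 2) * psi j x * (psi j y)^*) @ \oo --> k x y;
  mercer_trace : (\int[mu]_x (complex.Re (k x x))%:E
                  = \sum_(0 <= j <oo) (sigma j ^+ 2)%:E)%E;
  mercer_trace_fin : (\sum_(0 <= j <oo) (sigma j ^+ 2)%:E < +oo)%E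
}.

(* The functions sigma_j psi_j with sigma_j > 0 form an orthonormal basis of H
   (for sigma_j = 0 the vector e j is 0). *)
Definition mercer_basis (H : completeNormedModType (complexField R))
    (dot : {dot H for @Num.conj (complexField R)})
    (ev : {linear H -> (Omega -> complexField R)}) : Prop :=
  exists e : nat -> H,
    [/\ forall j, ev (e j) = (fun x => RtoC (sigma j) * psi j x),
        forall j l, 0 < sigma j -> 0 < sigma l -> dot (e j) (e l) = (j == l)%:R &
        forall f : H, series (fun j => dot f (e j) *: e j) @ \oo --> f].

Definition tail_sum (n : nat) : \bar R := (\sum_(n <= j <oo) (sigma j ^+ 2)%:E)%E.

Definition omega (n : nat) (x : Omega) : R :=
  2^-1 + fine (\sum_(n <= j <oo) (sigma j ^+ 2 * cmod (psi j x) ^+ 2)%:E)%E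
         / (2 * fine (tail_sum n)).

Definition quadrature (n N : nat) (xs : 'I_N -> Omega) (lam : 'I_N -> R) : Prop :=
  [/\ forall i, 0 <= lam i,
      \sum_(i < N) lam i = 1 &
      forall j l : 'I_n,
        \sum_(i < N) RtoC (lam i) * (psi j (xs i) * (psi l (xs i))^*
                                     / RtoC (omega n (xs i))) = (j == l)%:R].

Definition recovery_coef (n N : nat) (xs : 'I_N -> Omega) (lam : 'I_N -> R)
    (f : Omega -> complexField R) (j : nat) : complexField R :=
  \sum_(i < N) RtoC (lam i) / RtoC (omega n (xs i)) * f (xs i) * (psi j (xs i))^*.

Definition recovery (n N : nat) (xs : 'I_N -> Omega) (lam : 'I_N -> R)
    (f : Omega -> complexField R) : Omega -> complexField R :=
  fun x => \sum_(j < n) recovery_coef n xs lam f j * psi j x.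

End mercer.

(* Arithmetic expressions over inputs of type V.  There is no sharing of
   subexpressions and no constant but 0, so arith_ops bounds the cost of the
   evaluation from above. *)
Inductive arith (V : Type) : Type :=
| AInput of V
| AZero
| AAdd of arith V & arith V
| AMul of arith V & arith V
| ADiv of arith V & arith V
| AConj of arith V.
Arguments AZero {V}.

Fixpoint arith_eval (K : numClosedFieldType) (V : Type) (env : V -> K) (a : arith V) : K :=
  match a with
  | AInput v => env v
  | AZero => 0
  | AAdd a b => arith_eval env a + arith_eval env b
  | AMul a b => arith_eval env a * arith_eval env b
  | ADiv a b => arith_eval env a / arith_eval env b
  | AConj a => (arith_eval env a)^*
  end.

Fixpoint arith_ops (V : Type) (a : arith V) : nat :=
  match a with
  | AInput _ | AZero => 0
  | AAdd a b | AMul a b | ADiv a b => (arith_ops a + arith_ops b).+1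
  | AConj a => (arith_ops a).+1
  end.

(* The numbers from which a value S f(x) is computed: the samples f(x^i) and
   the precomputed lambda_i, omega_n(x^i), psi_j(x^i), psi_j(x). *)
Inductive recovery_input (n N : nat) : Type :=
| Sample of 'I_N
| Weight of 'I_N
| Density of 'I_N
| BasisAtNode of 'I_n & 'I_N
| BasisAtPoint of 'I_n.
Arguments Sample {n N}.
Arguments Weight {n N}.
Arguments Density {n N}.
Arguments BasisAtPoint {n N}.

(* The defining formula of S f(x), taken literally as an expression. *)
Definition recovery_formula (n N : nat) : arith (recovery_input n N) :=
  \big[@AAdd _/AZero]_(j < n)
    AMul
      (\big[@AAdd _/AZero]_(i < N)
         AMul (AMul (ADiv (AInput (Weight i)) (AInput (Density i)))
                    (AInput (Sample i)))
              (AConj (AInput (BasisAtNode j i))))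
      (AInput (BasisAtPoint j)).

Definition recovery_data (R : realType) (Omega : ptopologicalType)
    (sigma : nat -> R) (psi : nat -> Omega -> complexField R)
    (n N : nat) (xs : 'I_N -> Omega) (lam : 'I_N -> R)
    (f : Omega -> complexField R) (x : Omega)
    (v : recovery_input n N) : complexField R :=
  match v with
  | Sample i => f (xs i)
  | Weight i => RtoC (lam i)
  | Density i => RtoC (omega sigma psi n (xs i))
  | BasisAtNode j i => psi j (xs i)
  | BasisAtPoint j => psi j x
  end.

(* Main.v *)
(* Let P be the orthogonal projection of H(k) onto the span of the first n basis
   vectors, and r(x) = k(x,x) - k_n(x,x) the squared norm of the residual of the
   kernel vector at x; r integrates to the tail sum t and r <= 2 t omega_n.
   Quadrature: the map x |-> psi_j(x) conj(psi_l(x)) / omega_n(x) into the real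
   vector space of Hermitian matrices is continuous and its mean for the
   probability omega_n dmu is the identity, so Tchakaloff's theorem gives n^2+1
   nodes.  Upper bound: S reproduces P f and g = f - P f satisfies
   |g|^2 <= r pointwise, so |f - S f|^2 = |g|^2 + sum |c_j(g)|^2, where the first
   term is at most t and, by Bessel's inequality in the weighted C^N, the second
   is at most 2 t.  Lower bound: if L has rank n, restrict to the span of m basis
   vectors and take an orthonormal basis (u_i) of the kernel of L there; a bound c
   for the sup norm on the unit ball of the kernel gives sum_i |u_i(x)|^2 <= c^2,
   and integrating yields the truncated tail, since the sigma_j decrease. *)

Require Import Defs.
From HB Require Import structures.
From mathcomp Require Import all_boot all_order all_algebra.
From mathcomp Require Import all_classical all_reals all_analysis.
From mathcomp Require Import sesquilinear complex.
From mathcomp Require Import ring lra zify.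
Set Implicit Arguments.
Unset Strict Implicit.
Unset Printing Implicit Defensive.
Import Order.TTheory GRing.Theory Num.Theory.
Import numFieldNormedType.Exports.
Local Open Scope classical_set_scope.
Local Open Scope ring_scope.

(** * The complex field over [R]: real and imaginary parts, modulus, conjugation, continuity *)

Lemma continuous_epsdelta (K L : numFieldType) (f : K -> L) :
  (forall z e, 0 < e -> exists2 d, 0 < d &
     forall w, `|z - w| < d -> `|f z - f w| < e) -> continuous f.
Proof.
move=> H z; apply/(@cvgrPdist_lt _ _ _ _ (nbhs_filter z)) => e /(H z)[d d0 Hd].
by apply/nbhs_ballP; exists d => // w; rewrite -ball_normE => /Hd.
Qed.

Section ComplexField.
Variable R : realType.
Implicit Types (x y : R) (z w : complexField R).

Lemma RtoCD x y : RtoC (x + y) = RtoC x + RtoC y.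
Proof. exact: (rmorphD (real_complex R)). Qed.

Lemma RtoCM x y : RtoC (x * y) = RtoC x * RtoC y.
Proof. exact: (rmorphM (real_complex R)). Qed.

Lemma RtoCX x n : RtoC (x ^+ n) = RtoC x ^+ n.
Proof. exact: (rmorphXn (real_complex R)). Qed.

Lemma RtoC_sum (I : Type) (r : seq I) (P : pred I) (F : I -> R) :
  RtoC (\sum_(i <- r | P i) F i) = \sum_(i <- r | P i) RtoC (F i).
Proof. exact: (rmorph_sum (real_complex R)). Qed.

Lemma RtoC_eq0 x : (RtoC x == 0) = (x == 0).
Proof. exact: (fmorph_eq0 (real_complex R)). Qed.

Lemma RtoCV x : RtoC x^-1 = (RtoC x)^-1.
Proof. exact: (fmorphV (real_complex R)). Qed.

Lemma ler_RtoC x y : (RtoC x <= RtoC y) = (x <= y).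
Proof. exact: lecR. Qed.

Lemma conjC_RtoC x : (RtoC x)^* = RtoC x.
Proof. exact: conjc_real. Qed.

Lemma Re_conj z : complex.Re z^* = complex.Re z.
Proof. by case: z. Qed.

Lemma Im_conj z : complex.Im z^* = - complex.Im z.
Proof. by case: z. Qed.

Lemma ReD z w : complex.Re (z + w) = complex.Re z + complex.Re w.
Proof. by case: z w => [a b] [c d]. Qed.

Lemma ImD z w : complex.Im (z + w) = complex.Im z + complex.Im w.
Proof. by case: z w => [a b] [c d]. Qed.

Lemma ReN z : complex.Re (- z) = - complex.Re z.
Proof. by case: z. Qed.

Lemma ReM z w :
  complex.Re (z * w) = complex.Re z * complex.Re w - complex.Im z * complex.Im w.
Proof. by case: z w => [a b] [c d]. Qed.

Lemma ImM z w :
  complex.Im (z * w) = complex.Re z * complex.Im w + complex.Im z * complex.Re w.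
Proof. by case: z w => [a b] [c d]. Qed.

Lemma Re_sum (I : Type) (r : seq I) (P : pred I) (F : I -> complexField R) :
  complex.Re (\sum_(i <- r | P i) F i) = \sum_(i <- r | P i) complex.Re (F i).
Proof. exact: (big_morph _ ReD erefl). Qed.

Lemma Im_sum (I : Type) (r : seq I) (P : pred I) (F : I -> complexField R) :
  complex.Im (\sum_(i <- r | P i) F i) = \sum_(i <- r | P i) complex.Im (F i).
Proof. exact: (big_morph _ ImD erefl). Qed.

Lemma eq_complexP z w :
  complex.Re z = complex.Re w -> complex.Im z = complex.Im w -> z = w.
Proof. by case: z w => [a b] [c d] /= -> ->. Qed.

Lemma cmod_ge0 z : 0 <= cmod z.
Proof. by case: z => a b; rewrite /cmod /= sqrtr_ge0. Qed.

Lemma cmodM z w : cmod (z * w) = cmod z * cmod w.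
Proof. exact: Normc.normcM. Qed.

Lemma cmod_sqrE z : cmod z ^+ 2 = complex.Re z ^+ 2 + complex.Im z ^+ 2.
Proof. by case: z => a b; rewrite /cmod /= sqr_sqrtr ?addr_ge0 ?sqr_ge0. Qed.

Lemma cmod_sqr z : cmod z ^+ 2 = complex.Re (z * z^*).
Proof. by rewrite ReM Re_conj Im_conj cmod_sqrE mulrN opprK !expr2. Qed.

Lemma RtoC_cmod z : RtoC (cmod z) = `|z|.
Proof. by []. Qed.

Lemma RtoC_cmod_sqr z : RtoC (cmod z ^+ 2) = z * z^*.
Proof. by rewrite RtoCX RtoC_cmod normCK. Qed.

Lemma Re_RtoCM x z : complex.Re (RtoC x * z) = x * complex.Re z.
Proof. by rewrite ReM /= mul0r subr0. Qed.

Lemma ler_cmod_Re z : `|complex.Re z| <= cmod z.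
Proof.
by case: z => a b; rewrite /cmod /= -sqrtr_sqr ler_wsqrtr // lerDl sqr_ge0.
Qed.

Lemma ler_cmod_Im z : `|complex.Im z| <= cmod z.
Proof.
by case: z => a b; rewrite /cmod /= -sqrtr_sqr ler_wsqrtr // lerDr sqr_ge0.
Qed.

Lemma continuous_Re : continuous (fun z => complex.Re z).
Proof.
apply: continuous_epsdelta => z e e0; exists (RtoC e) => [|w]; rewrite ltcR //.
by apply: le_lt_trans; rewrite -ReN -ReD ler_cmod_Re.
Qed.

Lemma continuous_conj : continuous (fun z => z^*).
Proof.
apply: continuous_epsdelta => z e e0; exists e => // w.
by rewrite -rmorphB norm_conjC.
Qed.

End ComplexField.

(** * Integrability of continuous functions on a compact space *)

Section CompactIntegration.
Variables (R : realType) (Omega : ptopologicalType).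
Variable mu : probability (borelType Omega) R.
Hypothesis cptO : compact [set: Omega].
Implicit Types h : Omega -> R.

(** Open intervals generate the Borel sets of [R], and their preimages under [h] are open, hence
    among the generators of [borelType Omega]. *)
Lemma continuous_borel_measurable h :
  continuous h -> measurable_fun [set: borelType Omega] h.
Proof.
move=> /continuousP ch; apply: (measurability _
  (measurable_realfun.RGenOpens.measurableE R)).
move=> _ [_ [a [b ->] <-]]; rewrite setTI.
by apply: sub_sigma_algebra; exact/ch/interval_open.
Qed.

Lemma continuous_compact_bounded h :
  continuous h -> exists M : R, forall x, `|h x| <= M.
Proof.
move=> ch; have /compact_bounded[M [_ HM]] : compact (h @` setT).
  by apply: continuous_compact => //; exact: continuous_subspaceT.
exists (`|M| + 1) => x; apply: (HM (`|M| + 1)); last by exists x.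
by rewrite ltr_pwDr // ler_norm.
Qed.

Lemma continuous_integrable h :
  continuous h -> mu.-integrable [set: borelType Omega] (EFin \o h).
Proof.
move=> ch; apply: measurable_bounded_integrable => //.
- by rewrite [X in (X < _)%E]probability_setT ltry.
- exact: continuous_borel_measurable.
have [M HM] := continuous_compact_bounded ch.
by exists M; split; [exact: num_real|move=> y My x _; exact: le_trans (HM x) (ltW My)].
Qed.

End CompactIntegration.

(** * Pointwise algebra of continuous functions *)

Section ContinuousFunctions.
Variables (T : topologicalType) (K : numFieldType).
Implicit Types f g : T -> K.

Lemma continuous_const (c : K) : continuous (fun _ : T => c).
Proof. by move=> x; exact: cvg_cst. Qed.

Lemma continuous_add f g :
  continuous f -> continuous g -> continuous (fun x => f x + g x).
Proof. by move=> cf cg x; exact: cvgD (cf x) (cg x). Qed.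

Lemma continuous_opp f : continuous f -> continuous (fun x => - f x).
Proof. by move=> cf x; exact: cvgN (cf x). Qed.

Lemma continuous_mul f g :
  continuous f -> continuous g -> continuous (fun x => f x * g x).
Proof. by move=> cf cg x; exact: cvgM (cf x) (cg x). Qed.

Lemma continuous_sqr f : continuous f -> continuous (fun x => f x ^+ 2).
Proof. by move=> cf; exact (continuous_mul cf cf). Qed.

Lemma continuous_scale (c : K) f : continuous f -> continuous (fun x => c * f x).
Proof. by apply: continuous_mul => x; exact: cvg_cst. Qed.

Lemma continuous_sum (I : Type) (r : seq I) (P : pred I) (F : I -> T -> K) :
  (forall i, P i -> continuous (F i)) ->
  continuous (fun x => \sum_(i <- r | P i) F i x).
Proof.
move=> cF; elim: r => [|i r IH].
  by under eq_fun do rewrite big_nil; move=> x; exact: cvg_cst.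
case: (boolP (P i)) => Pi.
  by under eq_fun do rewrite big_cons Pi; exact: continuous_add (cF i Pi) IH.
by under eq_fun do rewrite big_cons (negbTE Pi).
Qed.

End ContinuousFunctions.

Lemma continuous_comp_fun (T U V : topologicalType) (f : T -> U) (g : U -> V) :
  continuous f -> continuous g -> continuous (fun x => g (f x)).
Proof. by move=> cf cg x; exact: (continuous_comp (cf x) (cg (f x))). Qed.

(** * Linearity and bounds for real and complex integrals of continuous functions *)

Section CompactIntegral.
Variables (R : realType) (Omega : ptopologicalType).
Variable mu : probability (borelType Omega) R.
Hypothesis cptO : compact [set: Omega].
Implicit Types (g h : Omega -> R) (f : Omega -> complexField R).

Local Notation rint := (Rintegral mu [set: borelType Omega]).

Lemma rintD g h : continuous g -> continuous h ->
  rint (fun x => g x + h x) = rint g + rint h.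
Proof. by move=> cg ch; apply: RintegralD => //; exact: continuous_integrable. Qed.

Lemma rintB g h : continuous g -> continuous h ->
  rint (fun x => g x - h x) = rint g - rint h.
Proof. by move=> cg ch; apply: RintegralB => //; exact: continuous_integrable. Qed.

Lemma rintZ r h : continuous h -> rint (fun x => r * h x) = r * rint h.
Proof. by move=> ch; apply: RintegralZl => //; exact: continuous_integrable. Qed.

Lemma rint_cst r : rint (fun=> r) = r.
Proof. by rewrite Rintegral_cst // [X in fine X]probability_setT /= mulr1. Qed.

Lemma rint_sum (I : Type) (s : seq I) (P : pred I) (F : I -> Omega -> R) :
  (forall i, P i -> continuous (F i)) ->
  rint (fun x => \sum_(i <- s | P i) F i x) = \sum_(i <- s | P i) rint (F i).
Proof.
move=> cF; elim: s => [|i s IH].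
  by rewrite big_nil -[RHS](rint_cst 0); congr rint; apply/funext=> x; rewrite big_nil.
rewrite big_cons; case: ifPn => Pi; last first.
  by rewrite -IH; congr rint; apply/funext=> x; rewrite big_cons (negbTE Pi).
rewrite -IH -rintD; first 2 [exact: cF|exact: continuous_sum].
by congr rint; apply/funext=> x; rewrite big_cons Pi.
Qed.

Lemma le_rint g h : continuous g -> continuous h ->
  (forall x, g x <= h x) -> rint g <= rint h.
Proof.
by move=> cg ch gh; apply: le_Rintegral => //; exact: continuous_integrable.
Qed.

Lemma integral_rint h : continuous h ->
  (\int[mu]_x (h x)%:E)%E = (rint h)%:E.
Proof.
move=> ch; rewrite /Rintegral fineK //; apply: integrable_fin_num => //.
exact: continuous_integrable.
Qed.

Lemma continuous_Re_comp f : continuous f -> continuous (fun x => complex.Re (f x)).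
Proof. by move=> cf; exact: continuous_comp_fun cf (@continuous_Re R). Qed.

Lemma continuous_conj_comp f : continuous f -> continuous (fun x => (f x)^*).
Proof. by move=> cf; exact: continuous_comp_fun cf (@continuous_conj R). Qed.

(** Multiplication by [-i] turns the imaginary part into a real part, so continuity of [Im] follows
    from that of [Re]. *)
Lemma Im_eq_Re (z : complexField R) : complex.Im z = complex.Re ((0 +i* (-1))%C * z).
Proof. by rewrite ReM /= mul0r sub0r mulN1r opprK. Qed.

Lemma continuous_Im_comp f : continuous f -> continuous (fun x => complex.Im (f x)).
Proof.
move=> cf; under eq_fun do rewrite Im_eq_Re.
by apply: continuous_Re_comp; exact: continuous_scale.
Qed.

Local Notation cint := (cintegral mu).

Lemma Re_cint f : complex.Re (cint f) = rint (fun x => complex.Re (f x)).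
Proof. by []. Qed.

Lemma Im_cint f : complex.Im (cint f) = rint (fun x => complex.Im (f x)).
Proof. by []. Qed.

Lemma cintD (f g : Omega -> complexField R) : continuous f -> continuous g ->
  cint (fun x => f x + g x) = cint f + cint g.
Proof.
move=> cf cg; apply: eq_complexP.
  rewrite ReD !Re_cint -rintD; try exact: continuous_Re_comp.
  by congr rint; apply/funext => x; rewrite ReD.
rewrite ImD !Im_cint -rintD; try exact: continuous_Im_comp.
by congr rint; apply/funext => x; rewrite ImD.
Qed.

Lemma cintZ c f : continuous f -> cint (fun x => c * f x) = c * cint f.
Proof.
move=> cf; have cRe := continuous_Re_comp cf; have cIm := continuous_Im_comp cf.
apply: eq_complexP.
  rewrite ReM !Re_cint Im_cint -!rintZ // -rintB; try exact: continuous_scale.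
  by congr rint; apply/funext => x; rewrite ReM.
rewrite ImM !Re_cint !Im_cint -!rintZ // -rintD; try exact: continuous_scale.
by congr rint; apply/funext => x; rewrite ImM.
Qed.

Lemma cint0 : cint (fun=> 0) = 0.
Proof. by apply: eq_complexP; rewrite /= [LHS]rint_cst. Qed.

Lemma cint_sum (I : Type) (s : seq I) (P : pred I)
    (F : I -> Omega -> complexField R) :
  (forall i, P i -> continuous (F i)) ->
  cint (fun x => \sum_(i <- s | P i) F i x) = \sum_(i <- s | P i) cint (F i).
Proof.
move=> cF; elim: s => [|i s IH].
  by rewrite big_nil -[RHS]cint0; congr cint; apply/funext=> x; rewrite big_nil.
rewrite big_cons; case: ifPn => Pi; last first.
  by rewrite -IH; congr cint; apply/funext=> x; rewrite big_cons (negbTE Pi).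
rewrite -IH -cintD; first 2 [exact: cF|exact: continuous_sum].
by congr cint; apply/funext=> x; rewrite big_cons Pi.
Qed.

Lemma cint_conj f : continuous f -> cint (fun x => (f x)^*) = (cint f)^*.
Proof.
move=> cf; apply: eq_complexP.
  by rewrite Re_conj !Re_cint; congr rint; apply/funext => x; rewrite Re_conj.
rewrite Im_conj !Im_cint -mulN1r -rintZ; last exact: continuous_Im_comp.
by congr rint; apply/funext => x; rewrite Im_conj mulN1r.
Qed.

Lemma continuous_cmod_sqr f : continuous f -> continuous (fun x => cmod (f x) ^+ 2).
Proof.
move=> cf; under eq_fun do rewrite cmod_sqr.
exact (continuous_Re_comp (continuous_mul cf (continuous_conj_comp cf))).
Qed.

Lemma sqnormL2_cint f : continuous f ->
  sqnormL2 mu f = (complex.Re (cint (fun x => f x * (f x)^*)))%:E.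
Proof.
move=> cf; rewrite /sqnormL2 integral_rint; last exact: continuous_cmod_sqr.
by rewrite Re_cint; congr (_%:E); congr rint; apply/funext => x; rewrite cmod_sqr.
Qed.

Lemma continuous_inL2 f : continuous f -> inL2 mu f.
Proof.
move=> cf; split; last by rewrite sqnormL2_cint // ltry.
by split; apply: continuous_borel_measurable;
  [exact: continuous_Re_comp|exact: continuous_Im_comp].
Qed.

(** Real and imaginary parts of the integral are each at most [M * B] in absolute value. The factor
    2 is a crude substitute for the square root of 2; the bound serves only to show that a
    functional on [H] is bounded. *)
Lemma cint_mul_bound (f g : Omega -> complexField R) (M B : R) :
  continuous f -> continuous g ->
  (forall x, cmod (f x) <= M) -> (forall x, cmod (g x) <= B) ->
  cmod (cint (fun x => f x * g x)) <= 2 * (M * B).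
Proof.
move=> cf cg fM gB; set h := fun x => f x * g x.
have ch : continuous h by exact (continuous_mul cf cg).
have hB x : cmod (h x) <= M * B.
  by rewrite cmodM ler_pM // ?cmod_ge0.
have bnd (u : Omega -> R) : continuous u -> (forall x, `|u x| <= M * B) ->
    `|rint u| <= M * B.
  move=> cu uB; rewrite ler_norml -[leLHS]rint_cst -[X in _ && (_ <= X)]rint_cst.
  have cc (r : R) : continuous (fun _ : Omega => r) by move=> x; exact: cvg_cst.
  by rewrite !le_rint // => x; have := uB x; rewrite ler_norml => /andP[].
have MB0 : 0 <= M * B by apply: le_trans (hB point); exact: cmod_ge0.
suff : cmod (cint h) ^+ 2 <= (2 * (M * B)) ^+ 2.
  have c0 := cmod_ge0 (cint h).
  have B0 : 0 <= 2 * (M * B) by rewrite mulr_ge0.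
  by move=> H; rewrite -(ler_pXn2r (n := 2)) //.
rewrite cmod_sqrE.
have hRe : `|rint (fun x => complex.Re (h x))| <= M * B.
  apply: bnd; first exact: continuous_Re_comp.
  by move=> x; exact: le_trans (ler_cmod_Re _) (hB x).
have hIm : `|rint (fun x => complex.Im (h x))| <= M * B.
  apply: bnd; first exact: continuous_Im_comp.
  by move=> x; exact: le_trans (ler_cmod_Im _) (hB x).
rewrite Re_cint Im_cint.
have sq (a t : R) : `|a| <= t -> a ^+ 2 <= t ^+ 2.
  by move=> at_; rewrite -(real_normK (num_real a)) lerXn2r ?nnegrE // (le_trans _ at_).
apply: le_trans (lerD (sq _ _ hRe) (sq _ _ hIm)) _.
rewrite [leRHS]exprMn -mulr2n -[leLHS]mulr_natl ler_wpM2r ?sqr_ge0 //.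
by rewrite -natrX ler_nat.
Qed.

End CompactIntegral.

(** * Bessel and Cauchy-Schwarz inequalities for a positive definite Hermitian form *)

Section DotProduct.
Variables (C : numClosedFieldType) (U : lmodType C).
Variable form : {dot U for @Num.conj C}.
Local Notation "''[' u , v ]" := (form u v) : ring_scope.

Lemma dot_conj u v : '[v, u] = ('[u, v])^*.
Proof. by rewrite hermC expr0 mul1r. Qed.

Lemma dot_suml (I : Type) (s : seq I) (P : pred I) (F : I -> U) v :
  '[\sum_(i <- s | P i) F i, v] = \sum_(i <- s | P i) '[F i, v].
Proof.
by elim/big_ind2: _ => [|a b c d <- <-|//]; rewrite ?linear0l ?linearDl.
Qed.

Lemma dot_sumr (I : Type) (s : seq I) (P : pred I) (F : I -> U) v :
  '[v, \sum_(i <- s | P i) F i] = \sum_(i <- s | P i) '[v, F i].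
Proof. exact: linear_sum. Qed.

(** With [p] the projection of [u], both ['[u, p]] and ['[p, p]] equal the real sum on the right, so
    three of the four terms of the expanded square collapse to one. *)
Lemma bessel_residual (I : finType) (e : I -> U) u :
  (forall i j, '[e i, e j] = (i == j)%:R) ->
  '[u - \sum_i '[u, e i] *: e i, u - \sum_i '[u, e i] *: e i]
    = '[u, u] - \sum_i `|'[u, e i]| ^+ 2.
Proof.
move=> one; set p := \sum_i _.
have up : '[u, p] = \sum_i `|'[u, e i]| ^+ 2.
  by rewrite dot_sumr; apply: eq_bigr => i _; rewrite linearZr_LR /= normCK mulrC.
have pp : '[p, p] = \sum_i `|'[u, e i]| ^+ 2.
  rewrite {1}/p dot_suml; apply: eq_bigr => i _; rewrite linearZl_LR /= normCK.
  congr (_ * _); rewrite dot_sumr (bigD1 i) //= big1 => [|j ji].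
    by rewrite linearZr_LR /= one eqxx mulr1 addr0.
  by rewrite linearZr_LR /= one eq_sym (negbTE ji) mulr0.
rewrite dnormB up pp geC0_conj; first by rewrite opprD addrA addrK.
by apply: sumr_ge0 => i _; rewrite exprn_ge0.
Qed.

Lemma bessel (I : finType) (e : I -> U) u :
  (forall i j, '[e i, e j] = (i == j)%:R) ->
  \sum_i `|'[u, e i]| ^+ 2 <= '[u, u].
Proof. by move=> one; rewrite -subr_ge0 -bessel_residual // dnorm_ge0. Qed.

(** Bessel's inequality for the one-element orthonormal family [v / sqrtC '[v, v]]. *)
Lemma cauchy_schwarz u v : `|'[u, v]| ^+ 2 <= '[u, u] * '[v, v].
Proof.
have [->|v0] := eqVneq v 0; first by rewrite linear0r normr0 expr0n mulr_ge0 ?dnorm_ge0.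
have vv0 : 0 < '[v, v] by rewrite dnorm_gt0.
have /(bessel (I := 'I_1) (e := fun=> (sqrtC '[v, v])^-1 *: v) u) :
    forall i j : 'I_1, '[(sqrtC '[v, v])^-1 *: v, (sqrtC '[v, v])^-1 *: v]
      = (i == j)%:R.
  move=> i j; rewrite !ord1 eqxx dnormZ normfV ger0_norm ?sqrtC_ge0 ?(ltW vv0) //.
  by rewrite exprVn sqrtCK mulVf // gt_eqF.
rewrite big_ord1 linearZr_LR /= normrM exprMn norm_conjC normfV.
rewrite (ger0_norm (x := sqrtC _)) ?sqrtC_ge0 ?(ltW vv0) // exprVn sqrtCK.
by rewrite mulrC ler_pdivrMr.
Qed.

End DotProduct.

(** * Removing one point from a convex combination *)

Section Caratheodory.
Variable R : realFieldType.

(** Any [D.+2] points of a [D]-dimensional space are affinely dependent: [A], with its extra column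
    of ones, has a nonzero row [c] in its left kernel. The entries of [c] sum to zero, so some are
    positive; subtracting [t * c] from [lam], with [t] the least ratio [lam i / c 0 i] over those,
    kills one weight and keeps the others nonnegative. *)
Lemma caratheodory_step (D : nat) (G : 'I_D.+2 -> 'I_D -> R) (lam : 'I_D.+2 -> R) :
  (forall i, 0 <= lam i) -> \sum_i lam i = 1 ->
  exists i0 (lam' : 'I_D.+2 -> R),
    [/\ forall i, 0 <= lam' i, \sum_i lam' i = 1, lam' i0 = 0 &
        forall d, \sum_i lam' i * G i d = \sum_i lam i * G i d].
Proof.
move=> lam0 lam1.
pose A : 'M[R]_(D.+2, 1 + D) := row_mx (const_mx 1) (\matrix_(i, d) G i d).
have [c c0 cA] : exists2 c : 'rV[R]_D.+2, c != 0 & c *m A = 0.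
  have : kermx A != 0.
    by rewrite -mxrank_eq0 mxrank_ker -lt0n subn_gt0 ltnS; exact: rank_leq_col.
  move=> /rowV0Pn[c /sub_kermxP cA c0]; by exists c.
move: cA; rewrite mul_mx_row => /eqP; rewrite row_mx_eq0 => /andP[/eqP c1 /eqP cG].
have sc : \sum_i c 0 i = 0.
  have /rowP/(_ 0) := c1; rewrite !mxE => c0d; rewrite -[RHS]c0d.
  by apply: eq_bigr => i _; rewrite mxE mulr1.
have sG d : \sum_i c 0 i * G i d = 0.
  have /rowP/(_ d) := cG; rewrite !mxE => c0d; rewrite -[RHS]c0d.
  by apply: eq_bigr => i _; rewrite mxE.
have [i1 ci1] : exists i, 0 < c 0 i.
  apply/existsP; apply: contraNT c0 => /existsPn cle.
  have cN i : 0 <= - c 0 i by rewrite oppr_ge0 leNgt cle.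
  apply/eqP/rowP => i; rewrite mxE; apply/eqP; rewrite -oppr_eq0.
  have /psumr_eq0P/(_ i erefl) -> // : \sum_i - c 0 i = 0 by rewrite sumrN sc oppr0.
have [i0 ci0 i0min] := @Order.TotalTheory.arg_minP _ R _ i1 (fun i => 0 < c 0 i)
  (fun i => lam i / c 0 i) ci1.
pose t := lam i0 / c 0 i0.
have t0 : 0 <= t by rewrite divr_ge0 // ltW.
exists i0, (fun i => lam i - t * c 0 i); split.
- move=> i; rewrite subr_ge0; have [ci|ci] := ltP 0 (c 0 i).
    by rewrite -ler_pdivlMr // i0min.
  by apply: le_trans (lam0 i); rewrite mulr_ge0_le0.
- by rewrite sumrB -mulr_sumr sc mulr0 subr0.
- by rewrite divfK ?subrr // gt_eqF.
- move=> d; under eq_bigr do rewrite mulrBl -mulrA.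
  by rewrite sumrB -mulr_sumr sG mulr0 subr0.
Qed.

End Caratheodory.

(** * Tchakaloff's theorem on a compact space *)

Section Tchakaloff.
Variables (R : realType) (T : ptopologicalType) (D : nat).
Variables (G : 'I_D -> T -> R) (m : 'I_D -> R).
Hypothesis cptT : compact [set: T].
Hypothesis cG : forall d, continuous (G d).

(** Weighted nodes form a point of a product space, so that Tychonoff's theorem yields
    compactness. *)
Local Notation config := (prod_topology (fun _ : 'I_D.+1 => (R * T)%type)).
Let dist2 (p : config) : R :=
  \sum_d (\sum_i (p i).1 * G d (p i).2 - m d) ^+ 2.
Let admissible : set config :=
  [set p | forall i, (`[0, 1] `*` setT) (p i)] `&` [set p | \sum_i (p i).1 = 1].

Let config_continuous_weight i : continuous (fun p : config => (p i).1).
Proof.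
have cp := @proj_continuous 'I_D.+1 (fun _ => (R * T)%type) i.
have c1 : continuous (@fst R T) by case=> x y; exact: cvg_fst.
exact (@continuous_comp_fun (config : topologicalType) (R * T)%type _ _ _ cp c1).
Qed.

Let config_continuous_node i : continuous (fun p : config => (p i).2).
Proof.
have cp := @proj_continuous 'I_D.+1 (fun _ => (R * T)%type) i.
have c1 : continuous (@snd R T) by case=> x y; exact: cvg_snd.
exact (@continuous_comp_fun (config : topologicalType) (R * T)%type _ _ _ cp c1).
Qed.

Let continuous_dist2 : continuous dist2.
Proof.
apply: continuous_sum => d _.
have c1 : continuous (fun p : config => \sum_i (p i).1 * G d (p i).2 - m d).
  refine (@continuous_add config R
    (fun p : config => \sum_i (p i).1 * G d (p i).2) (fun=> - m d) _
    (@continuous_const _ _ _)).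
  apply: continuous_sum => i _.
  apply: continuous_mul; first exact: config_continuous_weight.
  exact (continuous_comp_fun (@config_continuous_node i) (@cG d)).
exact (continuous_sqr c1).
Qed.

Let compact_admissible : compact admissible.
Proof.
apply: compact_closedI; last first.
  have cs : continuous (fun p : config => \sum_i (p i).1).
    by apply: continuous_sum => i _; exact: config_continuous_weight.
  exact (iffLR (@continuous_closedP config R _) cs _ (@closed_eq R 1)).
apply: (@tychonoff 'I_D.+1 (fun _ => (R * T)%type) (fun=> `[0, 1] `*` setT)) => i.
apply: compact_setX => //; exact: segment_compact.
Qed.

Let admissible0 : admissible !=set0.
Proof.
exists (fun i => ((i == ord0)%:R, point)); split=> [i|] /=.
  by split => //=; rewrite in_itv /=; case: eqP; rewrite ?lexx ler01.
rewrite (bigD1 ord0) //= big1 ?addr0 // => i /negbTE i0.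
by rewrite i0.
Qed.

(* The distance from m to the (D+1)-point averages of G is attained on the
   compact set of configurations; if it were positive, moving the minimiser
   slightly towards a point y with <v, G y - m> <= 0, v being the displacement,
   would decrease it, and caratheodory_step removes the extra point. *)
Lemma tchakaloff :
  (forall v : 'I_D -> R, exists y, \sum_d v d * (G d y - m d) <= 0) ->
  exists (xs : 'I_D.+1 -> T) (lam : 'I_D.+1 -> R),
    [/\ forall i, 0 <= lam i, \sum_i lam i = 1 &
        forall d, \sum_i lam i * G d (xs i) = m d].
Proof.
move=> sep.
have cd : {within admissible, continuous dist2} by exact: continuous_subspaceT.
have [p /set_mem [p01 p1] pmin] :=
  @compact_EVT_min config R _ _ admissible0 compact_admissible cd.
have pge0 i : 0 <= (p i).1 by have [/=] := p01 i; rewrite in_itv /= => /andP[].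
pose v d := \sum_i (p i).1 * G d (p i).2 - m d.
pose a := \sum_d v d ^+ 2.
have a_ge0 : 0 <= a by apply: sumr_ge0 => d _; exact: sqr_ge0.
suff a0 : a = 0.
  exists (fun i => (p i).2), (fun i => (p i).1); split => // d.
  apply/eqP; rewrite -subr_eq0 -sqrf_eq0; apply/eqP.
  by have /psumr_eq0P/(_ d erefl) -> := a0; move=> // e _; exact: sqr_ge0.
apply/eqP/negPn/negP => aN0; have a_gt0 : 0 < a by rewrite lt_def aN0.
have [y vy] := sep v.
pose w d := G d y - m d; pose b := \sum_d w d ^+ 2.
have b_ge0 : 0 <= b by apply: sumr_ge0 => d _; exact: sqr_ge0.
have ab0 : 0 < a + b by rewrite ltr_pwDl.
(* This [t] minimises [(1 - t) ^+ 2 * a + t ^+ 2 * b]; the minimum is [(1 - t) * a], strictly below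
   [a]. *)
pose t := a / (a + b).
have t0 : 0 < t by rewrite divr_gt0.
have t1 : 0 <= 1 - t by rewrite subr_ge0 ler_pdivrMr // mul1r lerDl.
have ta : (1 - t) * a = t * b.
  by rewrite /t; field; rewrite gt_eqF.
(* Index [ord0] carries the new node [y] with weight [t]; the old weights are scaled by [1 - t]. *)
pose x' (i : 'I_D.+2) := if unlift ord0 i is Some j then (p j).2 else y.
pose lam (i : 'I_D.+2) := if unlift ord0 i is Some j then (1 - t) * (p j).1 else t.
have lam_ge0 i : 0 <= lam i.
  by rewrite /lam; case: unliftP => [j _|_]; [rewrite mulr_ge0|exact: ltW].
have lam1 : \sum_i lam i = 1.
  rewrite big_ord_recl /lam unlift_none.
  under eq_bigr do rewrite liftK.
  by rewrite -mulr_sumr p1 mulr1 addrC subrK.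
have lamG d : \sum_i lam i * G d (x' i) - m d = (1 - t) * v d + t * w d.
  rewrite big_ord_recl /lam /x' unlift_none.
  under eq_bigr do rewrite liftK -mulrA.
  by rewrite -mulr_sumr /v /w; ring.
have [i0 [mu [mu0 mu1 mui0 muG]]] :=
  caratheodory_step (fun i d => G d (x' i)) lam_ge0 lam1.
pose q : config := fun j => (mu (lift i0 j), x' (lift i0 j)).
have q1 : \sum_j (q j).1 = 1 by rewrite -mu1 (bigD1_ord i0) //= mui0 add0r.
have q_adm : admissible q.
  split => // j; split => //=; rewrite in_itv /= mu0 /= -q1.
  by rewrite (bigD1 j) //= lerDl sumr_ge0.
have qG d : \sum_j (q j).1 * G d (q j).2 - m d = (1 - t) * v d + t * w d.
  by rewrite -lamG -muG (bigD1_ord i0) //= mui0 mul0r add0r.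
have := pmin q (mem_set q_adm); rewrite -[dist2 p]/a.
have -> : dist2 q = (1 - t) ^+ 2 * a + t ^+ 2 * b
                    + 2 * (t * (1 - t)) * \sum_d v d * w d.
  rewrite /dist2 /a /b !mulr_sumr -!big_split /=.
  by apply: eq_bigr => d _; rewrite qG; ring.
have s0 : 2 * (t * (1 - t)) * \sum_d v d * w d <= 0.
  exact: mulr_ge0_le0 (mulr_ge0 (ler0n R 2) (mulr_ge0 (ltW t0) t1)) vy.
have -> : (1 - t) ^+ 2 * a + t ^+ 2 * b = (1 - t) * a.
  by rewrite expr2 -mulrA ta; ring.
move=> abs; have : t * a <= 0.
  by move: abs s0; rewrite mulrBl mul1r; move: (_ * \sum_d _) (t * a) => X Y; lra.
by apply/negP; rewrite -ltNge; exact: mulr_gt0.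
Qed.

End Tchakaloff.

(** * Series of nonnegative reals with finite sum, and the dimension of [H] *)

Lemma eseries_tail (R : realType) (u : nat -> R) (l : R) (n : nat) :
  (forall j, 0 <= u j) -> (\sum_(0 <= j <oo) (u j)%:E = l%:E)%E ->
  (\sum_(n <= j <oo) (u j)%:E = (l - \sum_(j < n) u j)%:E)%E.
Proof.
move=> u0; rewrite (nneseries_split 0 n); last by move=> k _; rewrite lee_fin.
rewrite add0n sumEFin big_mkord => ltot.
by rewrite EFinB -ltot addeAC subee // add0e.
Qed.

Lemma eseries_cvg (R : realType) (u : nat -> R) (l : R) :
  series u @ \oo --> l -> (\sum_(0 <= j <oo) (u j)%:E = l%:E)%E.
Proof.
move=> ul; apply/cvg_lim => //.
rewrite (_ : (fun m => _) = EFin \o series u); first exact: cvg_comp ul _.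
by apply/funext => m /=; rewrite sumEFin.
Qed.

Section Dimension.
Variables (R : realType) (Omega : ptopologicalType).
Variable H : completeNormedModType (complexField R).
Variable dot : {dot H for @Num.conj (complexField R)}.

(* Otherwise H would be spanned by e 0, ..., e (n-1). *)
Lemma lt_dim_basis_neq0 (e : nat -> H) (n : nat) :
  (forall f : H, series (fun j => dot f (e j) *: e j) @ \oo --> f) ->
  lt_dim H n -> exists2 j, (n <= j)%N & e j != 0.
Proof.
move=> eB [v vfree]; apply: contrapT => noj.
have e0 j : (n <= j)%N -> e j = 0.
  by move=> nj; apply: contrapT => /eqP ej; apply: noj; exists j.
have span f : f = \sum_(j < n) dot f (e j) *: e j.
  rewrite -[LHS](@cvg_lim _ (@norm_hausdorff _ H) _ _ _ _ _ (eB f)).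
  apply: (@cvg_lim _ (@norm_hausdorff _ H)).
  apply: cvg_near_cst; exists n => // m /= nm.
  rewrite seriesEord /= -(subnKC nm) big_split_ord /= [X in _ + X]big1 ?addr0 //.
  by move=> i _; rewrite e0 ?scaler0 // leq_addr.
(* The coordinates of the [n.+1] vectors [v i] form a matrix with only [n] columns; a nonzero row in
   its left kernel is a linear relation contradicting [vfree]. *)
pose M := \matrix_(i < n.+1, j < n) dot (v i) (e j).
have : kermx M != 0.
  by rewrite -mxrank_eq0 mxrank_ker -lt0n subn_gt0 ltnS; exact: rank_leq_col.
move=> /rowV0Pn[a /sub_kermxP aM]; apply/negP; rewrite negbK.
apply/eqP/rowP => i; rewrite mxE; apply: vfree.
rewrite [LHS]span big1 // => j _; rewrite dot_suml.
rewrite (eq_bigr (fun i => a 0 i * M i j)) => [|l _]; last first.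
  by rewrite linearZl_LR mxE.
by have /rowP/(_ j) := aM; rewrite !mxE => ->; rewrite scale0r.
Qed.

End Dimension.

(** * Functions of a reproducing kernel Hilbert space with continuous kernel *)

Section ReproducingKernel.
Variables (R : realType) (Omega : ptopologicalType).
Variable k : Omega -> Omega -> complexField R.
Variable H : completeNormedModType (complexField R).
Variable dot : {dot H for @Num.conj (complexField R)}.
Variable ev : {linear H -> (Omega -> complexField R)}.
Variable kv : Omega -> H.
Hypothesis kvE : forall y, ev (kv y) = (fun x => k x y).
Hypothesis evE : forall f y, ev f y = dot f (kv y).
Hypothesis kcont : continuous (fun p : Omega * Omega => k p.1 p.2).

Lemma dot_kv x y : dot (kv y) (kv x) = k x y.
Proof. by rewrite -evE kvE. Qed.

Lemma ev_bound f x : `|ev f x| ^+ 2 <= dot f f * k x x.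
Proof. by rewrite evE -dot_kv; exact: cauchy_schwarz. Qed.

Let continuous_kernel_comp (u v : Omega -> Omega) :
  continuous u -> continuous v -> continuous (fun y => k (u y) (v y)).
Proof.
move=> cu cv.
have cp : continuous (fun y => (u y, v y)) by move=> y; exact: cvg_pair (cu y) (cv y).
exact (continuous_comp_fun cp kcont).
Qed.

(** By Cauchy-Schwarz [|f x - f y| ^+ 2] is at most [dot f f * h x y], where [h x y] is the squared
    distance of the kernel vectors. Expanded in terms of [k], it is continuous in [y], and it
    vanishes at [y = x]. *)
Lemma continuous_ev f : continuous (ev f).
Proof.
pose h x y := dot (kv x - kv y) (kv x - kv y).
have hE x y : h x y = k x x + k y y - (k y x + (k y x)^*).
  by rewrite /h dnormB !dot_kv.
have ch x : continuous (h x).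
  have cid : continuous (@idfun Omega) by move=> y; exact: cvg_id.
  have cx : continuous (fun _ : Omega => x) by move=> y; exact: cvg_cst.
  have c1 := continuous_kernel_comp cid cx.
  have c2 := continuous_add (@continuous_const Omega (complexField R) (k x x))
    (continuous_kernel_comp cid cid).
  have c3 := continuous_opp (continuous_add c1 (continuous_conj_comp c1)).
  rewrite (_ : h x = (fun y => k x x + k y y - (k y x + (k y x)^*))).
    exact (continuous_add c2 c3).
  by apply/funext => y; rewrite hE.
move=> x; apply/(@cvgrPdist_lt _ _ _ _ (nbhs_filter x)) => eps eps0.
have d0 : 0 <= dot f f by exact: dnorm_ge0.
have d1 : 0 < dot f f + 1 by rewrite ltr_wpDl.
(* Adding 1 keeps the divisor positive when [f] is zero. *)
have e20 : 0 < eps ^+ 2 / (dot f f + 1) by rewrite divr_gt0 ?exprn_gt0.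
have hx0 : h x x = 0 by rewrite /h subrr linear0r.
have /(@cvgrPdist_lt _ _ _ _ (nbhs_filter x))/(_ _ e20) := ch x x.
rewrite hx0; apply: (@filterS _ _ (nbhs_filter x)) => y /=.
rewrite sub0r normrN ger0_norm ?dnorm_ge0 // ltr_pdivlMr // => hy.
rewrite -(ltr_pXn2r (n := 2)) ?nnegrE ?(ltW eps0) //.
rewrite !evE -linearBr; apply: le_lt_trans (cauchy_schwarz _ _ _) _.
apply: le_lt_trans hy; rewrite mulrC ler_wpM2l ?dnorm_ge0 //.
by rewrite lerDl.
Qed.

End ReproducingKernel.

(** * Quadrature that preserves the orthonormality of finitely many functions *)

Section Quadrature.
Variables (R : realType) (Omega : ptopologicalType).
Variable mu : probability (borelType Omega) R.
Hypothesis cptO : compact [set: Omega].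
Local Notation rint := (Rintegral mu [set: borelType Omega]).

(** Tchakaloff's theorem for the functions [g d / w] and the probability density [w]. Its hypothesis
    holds because, for each [v], the continuous function [h] has mean zero with respect to [w], so
    its minimum over the compact space is at most zero. *)
Lemma weighted_tchakaloff (I : finType) (g : I -> Omega -> R) (w : Omega -> R) :
  (forall d, continuous (g d)) -> continuous w -> (forall x, 0 < w x) ->
  rint w = 1 ->
  exists (xs : 'I_#|I|.+1 -> Omega) (lam : 'I_#|I|.+1 -> R),
    [/\ forall i, 0 <= lam i, \sum_i lam i = 1 &
        forall d, \sum_i lam i * (g d (xs i) / w (xs i)) = rint (g d)].
Proof.
move=> cg cw w0 w1.
pose G (d : 'I_#|I|) x := g (enum_val d) x / w x.
pose m (d : 'I_#|I|) := rint (g (enum_val d)).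
have cG d : continuous (G d).
  move=> x; apply: cvgM (cg _ x) _; apply: cvgV (cw x).
  by rewrite gt_eqF.
have sep (v : 'I_#|I| -> R) : exists y, \sum_d v d * (G d y - m d) <= 0.
  pose h y := \sum_d v d * (G d y - m d).
  have ch : continuous h.
    apply: continuous_sum => d _; apply: continuous_scale.
    exact (continuous_add (cG d) (@continuous_const _ _ _)).
  have cw' : {within [set: Omega], continuous h} by exact: continuous_subspaceT.
  have [|y _ ymin] := @compact_EVT_min Omega R h setT _ cptO cw'.
    by exists point.
  exists y; rewrite -/(h y).
  have cterm d : continuous (fun x => g (enum_val d) x - m d * w x).
    exact (continuous_add (cg _) (continuous_opp (continuous_scale cw))).
  suff hw0 : rint (fun x => h x * w x) = 0.
    rewrite -hw0 -[h y]mulr1 -w1 -rintZ //; apply: le_rint => //.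
    - exact (continuous_scale cw).
    - exact (continuous_mul ch cw).
    - by move=> x; rewrite ler_wpM2r ?(ltW (w0 x)) // ymin // inE.
  rewrite (_ : (fun x => _) =
    (fun x => \sum_d v d * (g (enum_val d) x - m d * w x))); last first.
    apply/funext => x; rewrite /h mulr_suml; apply: eq_bigr => d _.
    by rewrite -mulrA mulrBl /G divfK // gt_eqF.
  rewrite rint_sum // => [|d _]; last exact (continuous_scale (cterm d)).
  rewrite big1 // => d _; rewrite rintZ // rintB //.
    by rewrite rintZ // w1 mulr1 subrr mulr0.
  exact (continuous_scale cw).
have [xs [lam [l0 l1 lG]]] := tchakaloff cptO cG sep.
exists xs, lam; split => // d.
by have := lG (enum_rank d); rewrite /G /m enum_rankK.
Qed.

(* The Hermitian n x n matrices form a real vector space of dimension n^2: the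
   upper triangle is encoded by real parts, the strict lower one by imaginary
   parts. *)
Lemma orthonormal_quadrature (n : nat) (phi : 'I_n -> Omega -> complexField R)
    (w : Omega -> R) :
  (forall j, continuous (phi j)) ->
  (forall j l, cintegral mu (fun x => phi j x * (phi l x)^*) = (j == l)%:R) ->
  continuous w -> (forall x, 0 < w x) -> rint w = 1 ->
  exists (N : nat) (xs : 'I_N -> Omega) (lam : 'I_N -> R),
    [/\ (N <= n ^ 2 + 1)%N, forall i, 0 <= lam i, \sum_i lam i = 1 &
        forall j l, \sum_i RtoC (lam i) *
          (phi j (xs i) * (phi l (xs i))^* / RtoC (w (xs i))) = (j == l)%:R].
Proof.
move=> cphi one cw w0 w1.
pose z (j l : 'I_n) x := phi j x * (phi l x)^*.
have cz j l : continuous (z j l).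
  exact (continuous_mul (cphi j) (continuous_conj_comp (cphi l))).
pose g (d : 'I_n * 'I_n) x : R :=
  if (d.1 <= d.2)%N then complex.Re (z d.1 d.2 x) else complex.Im (z d.1 d.2 x).
have cg d : continuous (g d).
  rewrite /g; case: (d.1 <= d.2)%N; first exact (continuous_Re_comp (cz _ _)).
  exact (continuous_Im_comp (cz _ _)).
have [xs [lam [l0 l1 lg]]] := weighted_tchakaloff cg cw w0 w1.
exists _, xs, lam; split => //.
  by rewrite card_prod card_ord addn1 expnS expn1.
pose q j l := \sum_i RtoC (lam i) * (z j l (xs i) / RtoC (w (xs i))).
have qRe j l : complex.Re (q j l) = \sum_i lam i * (complex.Re (z j l (xs i)) / w (xs i)).
  rewrite Re_sum; apply: eq_bigr => i _.
  by rewrite -RtoCV Re_RtoCM [z _ _ _ * _]mulrC Re_RtoCM mulrC [_^-1 * _]mulrC mulrC.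
have qIm j l : complex.Im (q j l) = \sum_i lam i * (complex.Im (z j l (xs i)) / w (xs i)).
  rewrite Im_sum; apply: eq_bigr => i _.
  by rewrite -RtoCV ImM /= mul0r addr0 [z _ _ _ * _]mulrC
    ImM /= mul0r addr0 [_^-1 * _]mulrC.
(* The quadrature prescribes the real parts of [q] on and above the diagonal and the imaginary parts
   below it. Hermitian symmetry carries the latter above the diagonal, makes the diagonal real, and
   finally yields the lower triangle. *)
have qC j l : q l j = (q j l)^*.
  rewrite rmorph_sum; apply: eq_bigr => i _.
  by rewrite -RtoCV !rmorphM /= !conjC_RtoC conjCK [_^* * _]mulrC.
have upRe (j l : 'I_n) : (j <= l)%N -> complex.Re (q j l) = (j == l)%:R.
  move=> jl; rewrite qRe; have := lg (j, l); rewrite /g /= jl => ->.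
  by rewrite -Re_cint one; case: eqP.
have upIm (j l : 'I_n) : (j < l)%N -> complex.Im (q j l) = 0.
  move=> jl; suff lj : complex.Im (q l j) = 0 by rewrite qC Im_conj lj oppr0.
  rewrite qIm; have := lg (l, j); rewrite /g /= leqNgt jl /= => ->.
  by rewrite -Im_cint one; case: eqP.
have diIm j : complex.Im (q j j) = 0.
  have /(congr1 (fun u : complexField R => complex.Im u)) := qC j j.
  by rewrite Im_conj; lra.
have up (j l : 'I_n) : (j <= l)%N -> q j l = (j == l)%:R.
  move=> jl; apply: eq_complexP; first by rewrite upRe //; case: eqP.
  move: jl; rewrite leq_eqVlt => /orP[/eqP/val_inj->|jl]; first by rewrite diIm eqxx.
  by rewrite upIm // -val_eqE (ltn_eqF jl).
move=> j l; rewrite -[LHS]/(q j l).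
have [/up//|/ltnW lj] := leqP j l.
by rewrite qC up // eq_sym; case: eqP; rewrite ?rmorph1 ?rmorph0.
Qed.

End Quadrature.

(* Each summand of the difference dominates s n times (w j - [n <= j]). *)
Lemma sum_tail_le_weighted (R : realFieldType) (n m : nat) (s : nat -> R)
    (w : 'I_m -> R) :
  (forall i j, (i <= j)%N -> s j <= s i) -> 0 <= s n ->
  (forall j, 0 <= w j <= 1) -> (m - n)%:R <= \sum_j w j ->
  \sum_(j < m | (n <= j)%N) s j <= \sum_(j < m) s j * w j.
Proof.
move=> sdec sn w01 wsum.
have card_tail : \sum_(j < m) ((n <= j)%N%:R : R) = (m - n)%:R.
  have <- : \sum_(n <= j < m) 1%N = (m - n)%N by rewrite sum_nat_const_nat muln1.
  rewrite (@big_nat_widenl _ _ _ n 0%N) // big_mkord natr_sum [RHS]big_mkcond /=.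
  by apply: eq_bigr => j _; case: leqP.
rewrite -subr_ge0 [X in _ - X]big_mkcond -sumrB.
apply: le_trans (_ : s n * (\sum_j w j - (m - n)%:R) <= _).
  by rewrite mulr_ge0 // subr_ge0.
rewrite -card_tail -sumrB mulr_sumr; apply: ler_sum => j _.
have /andP[w0 w1] := w01 j; case: leqP => nj /=.
  have := sdec _ _ nj; nra.
have := sdec _ _ (ltnW nj); nra.
Qed.

(** * The Mercer kernel: residual on the diagonal, tail sum and density *)

Section MercerKernel.
Variables (R : realType) (Omega : ptopologicalType).
Variable mu : probability (borelType Omega) R.
Variable k : Omega -> Omega -> complexField R.
Variables (sigma : nat -> R) (psi : nat -> Omega -> complexField R).
Variable H : completeNormedModType (complexField R).
Variable dot : {dot H for @Num.conj (complexField R)}.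
Variable ev : {linear H -> (Omega -> complexField R)}.
Variable kv : Omega -> H.
Variable e : nat -> H.
Variable n : nat.
Hypothesis cptO : compact [set: Omega].
Hypothesis mercer : is_mercer mu k sigma psi.
Hypothesis kvE : forall y, ev (kv y) = (fun x => k x y).
Hypothesis evE : forall f y, ev f y = dot f (kv y).
Hypothesis eE : forall j, ev (e j) = (fun x => RtoC (sigma j) * psi j x).
Hypothesis eON : forall j l, 0 < sigma j -> 0 < sigma l ->
  dot (e j) (e l) = (j == l)%:R.
Hypothesis sigma_n : 0 < sigma n.

Local Notation rint := (Rintegral mu [set: borelType Omega]).
Local Notation cint := (cintegral mu).

Lemma sigma_gt0 j : (j <= n)%N -> 0 < sigma j.
Proof.
by move=> jn; apply: lt_le_trans sigma_n _; exact: (mercer_nonincreasing mercer).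
Qed.

Let sigma_ord (j : 'I_n) : 0 < sigma j.
Proof. by apply: sigma_gt0; rewrite ltnW. Qed.

(** The Mercer data only place [psi j] in L_2; continuity comes from [H], since [psi j] is
    [ev (e j)] divided by [sigma j]. *)
Lemma continuous_psi j : 0 < sigma j -> continuous (psi j).
Proof.
move=> sj; rewrite (_ : psi j = (fun x => (RtoC (sigma j))^-1 * ev (e j) x)).
  exact (continuous_scale
    (@continuous_ev _ _ k _ dot ev kv kvE evE (mercer_continuous mercer) (e j))).
by apply/funext => x; rewrite eE mulKf // RtoC_eq0 gt_eqF.
Qed.

Lemma dot_e_kv j x : dot (e j) (kv x) = RtoC (sigma j) * psi j x.
Proof. by rewrite -evE eE. Qed.

Lemma eON_ord (i j : 'I_n) : dot (e i) (e j) = (i == j)%:R.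
Proof. by rewrite eON. Qed.

(** The part of the kernel vector orthogonal to the first [n] basis vectors. It represents
    evaluation at [x] of the projection residual, see [ev_projection_residual]. *)
Definition kernel_residual (x : Omega) : H :=
  kv x - \sum_(j < n) dot (kv x) (e j) *: e j.

(** This is [k(x,x) - k_n(x,x)]. Being a finite expression it is visibly continuous, and
    [omega_series] identifies it with the series in [omega]. *)
Definition residual_diag (x : Omega) : R :=
  complex.Re (k x x) - \sum_(j < n) sigma j ^+ 2 * cmod (psi j x) ^+ 2.

(** The diagonal value is the squared norm of [kv x]. *)
Lemma kernel_diag_real x : k x x = RtoC (complex.Re (k x x)).
Proof.
have := dnorm_ge0 dot (kv x); rewrite (dot_kv kvE evE) lecE => /andP[/eqP i0 _].
by apply: eq_complexP => //=; rewrite -i0.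
Qed.

Lemma sqnorm_kernel_residual x :
  dot (kernel_residual x) (kernel_residual x) = RtoC (residual_diag x).
Proof.
rewrite bessel_residual; last exact: eON_ord.
rewrite (dot_kv kvE evE) kernel_diag_real -[- (\sum_(j < n) _)]mulN1r.
rewrite /residual_diag -[- (\sum_(j < n) _)]mulN1r RtoCD RtoCM RtoC_sum.
congr (_ + _ * _).
  by apply: eq_complexP; rewrite /= ?oppr0.
apply: eq_bigr => j _; rewrite dot_conj norm_conjC dot_e_kv normrM exprMn.
by rewrite RtoCM !RtoCX [`|RtoC _|]ger0_norm // ler0c ltW.
Qed.

Lemma residual_diag_ge0 x : 0 <= residual_diag x.
Proof. by rewrite -ler_RtoC -sqnorm_kernel_residual; exact: dnorm_ge0. Qed.

Lemma diag_series_cvg x :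
  series (fun j => sigma j ^+ 2 * cmod (psi j x) ^+ 2) @ \oo --> complex.Re (k x x).
Proof.
have := cvg_comp _ _ (@mercer_expansion _ _ _ _ _ _ mercer x x)
  (@continuous_Re R (k x x)).
rewrite (_ : _ \o _ = series (fun j => sigma j ^+ 2 * cmod (psi j x) ^+ 2)) //.
apply/funext => m; rewrite /series /= Re_sum; apply: eq_bigr => j _.
by rewrite -mulrA Re_RtoCM cmod_sqr.
Qed.

Lemma omega_series x :
  (\sum_(n <= j <oo) (sigma j ^+ 2 * cmod (psi j x) ^+ 2)%:E = (residual_diag x)%:E)%E.
Proof.
apply: eseries_tail => [j|]; first by rewrite mulr_ge0 ?sqr_ge0.
exact/eseries_cvg/diag_series_cvg.
Qed.

Let continuous_kxx : continuous (fun x => complex.Re (k x x)).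
Proof.
have cp : continuous (fun y : Omega => (y, y)).
  by move=> y; apply: cvg_pair; exact: cvg_id.
exact (continuous_Re_comp (continuous_comp_fun cp (mercer_continuous mercer))).
Qed.

Let continuous_term (j : 'I_n) :
  continuous (fun x => sigma j ^+ 2 * cmod (psi j x) ^+ 2).
Proof. exact (continuous_scale (continuous_cmod_sqr (continuous_psi (sigma_ord j)))). Qed.

Let continuous_terms :
  continuous (fun x => \sum_(j < n) sigma j ^+ 2 * cmod (psi j x) ^+ 2).
Proof. by apply: continuous_sum => j _; exact: continuous_term. Qed.

Lemma continuous_residual_diag : continuous residual_diag.
Proof. exact (continuous_add continuous_kxx (continuous_opp continuous_terms)). Qed.

Definition tail_real : R := fine (tail_sum sigma n).

Let tail_sumE0 : tail_sum sigma n =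
  (rint (fun x => complex.Re (k x x)) - \sum_(j < n) sigma j ^+ 2)%:E.
Proof.
apply: eseries_tail => [j|]; first exact: sqr_ge0.
by rewrite -(mercer_trace mercer) integral_rint.
Qed.

Lemma tail_sumE : tail_sum sigma n = tail_real%:E.
Proof. by rewrite /tail_real tail_sumE0. Qed.

Lemma rint_cmod_psi j : 0 < sigma j -> rint (fun x => cmod (psi j x) ^+ 2) = 1.
Proof.
move=> sj; have := mercer_orthonormal mercer sj sj.
rewrite eqxx => /(congr1 (fun z : complexField R => complex.Re z)) /= <-.
by congr rint; apply/funext => x; rewrite cmod_sqr.
Qed.

Lemma rint_residual_diag : rint residual_diag = tail_real.
Proof.
rewrite /tail_real tail_sumE0 /= -[LHS]/(rint (fun x => _ - _)) rintB //.
congr (_ - _); rewrite rint_sum //.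
apply: eq_bigr => j _; rewrite rintZ ?rint_cmod_psi ?mulr1 //.
exact (continuous_cmod_sqr (continuous_psi (sigma_ord j))).
Qed.

(** The term of index [n] alone is positive; this makes the division in [omega] meaningful. *)
Lemma tail_real_gt0 : 0 < tail_real.
Proof.
rewrite -lte_fin -tail_sumE.
have lb : (\sum_(n <= j < n.+1) (sigma j ^+ 2)%:E <= tail_sum sigma n)%E.
  by apply: nneseries_lim_ge => j _ _; rewrite lee_fin sqr_ge0.
by apply: lt_le_trans lb; rewrite big_nat1 lte_fin exprn_gt0.
Qed.

Lemma omegaE x : omega sigma psi n x = 2^-1 + residual_diag x / (2 * tail_real).
Proof. by rewrite /omega omega_series. Qed.

(** The second summand of [omega] alone already gives equality. The summand [2^-1] gives the
    positivity in [omega_gt0]. *)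
Lemma residual_diag_le_omega x :
  residual_diag x <= 2 * tail_real * omega sigma psi n x.
Proof.
have t0 := tail_real_gt0.
rewrite omegaE mulrDr mulrCA divff ?mulr1 ?mulf_neq0 ?gt_eqF //.
by rewrite lerDr mulr_ge0 ?invr_ge0 // mulr_ge0 // ltW.
Qed.

Lemma omega_gt0 x : 0 < omega sigma psi n x.
Proof.
have t0 := tail_real_gt0.
rewrite omegaE ltr_wpDr ?invr_gt0 // divr_ge0 ?residual_diag_ge0 //.
by rewrite mulr_ge0 // ltW.
Qed.

Lemma continuous_omega : continuous (omega sigma psi n).
Proof.
rewrite (_ : omega _ _ _ =
  (fun x => 2^-1 + (2 * tail_real)^-1 * residual_diag x)); last first.
  by apply/funext => x; rewrite omegaE mulrC.
exact (continuous_add (@continuous_const _ _ _)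
  (continuous_scale continuous_residual_diag)).
Qed.

Lemma rint_omega : rint (omega sigma psi n) = 1.
Proof.
have t0 := tail_real_gt0; have cr := continuous_residual_diag.
rewrite (_ : omega _ _ _ =
  (fun x => 2^-1 + (2 * tail_real)^-1 * residual_diag x)); last first.
  by apply/funext => x; rewrite omegaE mulrC.
rewrite rintD // ?rint_cst ?rintZ // ?rint_residual_diag.
- by field; rewrite gt_eqF.
- exact: continuous_const.
- exact (continuous_scale cr).
Qed.

(** * Comparison of [H] with L_2, and the projection onto the first basis vectors *)

Hypothesis ev_inj : injective ev.
Hypothesis dot_norm : forall f : H, dot f f = `|f| ^+ 2.
Hypothesis eB : forall f : H, series (fun j => dot f (e j) *: e j) @ \oo --> f.

Let cev f : continuous (ev f).
Proof. exact (@continuous_ev _ _ k _ dot ev kv kvE evE (mercer_continuous mercer) f). Qed.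

Lemma ev_scaleD a f g x : ev (a *: f + g) x = a * ev f x + ev g x.
Proof. by rewrite linearP. Qed.

Lemma basis_eq0 j : ~~ (0 < sigma j) -> e j = 0.
Proof.
move=> sj; have s0 : sigma j = 0.
  by apply/eqP; rewrite eq_le (mercer_ge0 mercer) andbT leNgt.
apply: ev_inj; rewrite eE s0 linear0.
by apply/funext => x; rewrite (_ : RtoC 0 = 0) // mul0r.
Qed.

Lemma continuous_cmod_bounded (h : Omega -> complexField R) :
  continuous h -> exists M : R, forall x, cmod (h x) <= M.
Proof.
move=> ch; have [M HM] := continuous_compact_bounded cptO (continuous_cmod_sqr ch).
exists (1 + M) => x; apply: le_trans (_ : 1 + cmod (h x) ^+ 2 <= _).
  by have := cmod_ge0 (h x); nra.
by rewrite lerD2l; exact: le_trans (ler_norm _) (HM x).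
Qed.

Lemma ev_cmod_bounded : exists2 K : R, 0 <= K &
  forall (f : H) (r : R), `|f| <= RtoC r -> forall x, cmod (ev f x) <= r * K.
Proof.
have [M HM] := continuous_compact_bounded cptO continuous_kxx.
have K0 : 0 <= 1 + M by rewrite addr_ge0 // (le_trans _ (HM point)).
(* Using [1 + M] instead of the square root of [M] suffices, since [M <= (1 + M) ^+ 2]. *)
exists (1 + M) => // f r fr x.
have r0 : 0 <= r by rewrite -ler_RtoC; exact: le_trans (normr_ge0 f) fr.
suff : RtoC (cmod (ev f x)) ^+ 2 <= RtoC (r * (1 + M)) ^+ 2.
  rewrite -!RtoCX ler_RtoC => h2.
  have rK : 0 <= r * (1 + M) by exact: mulr_ge0.
  by rewrite -(ler_pXn2r (n := 2)) // nnegrE ?cmod_ge0.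
apply: le_trans (ev_bound kvE evE f x) _.
have kx0 : 0 <= complex.Re (k x x).
  by rewrite -ler_RtoC -kernel_diag_real -(dot_kv kvE evE); exact: dnorm_ge0.
have kxM : complex.Re (k x x) <= M by exact: le_trans (ler_norm _) (HM x).
rewrite dot_norm kernel_diag_real RtoCM exprMn; apply: ler_pM => //.
- by rewrite ler0c.
- by rewrite lerXn2r // nnegrE // ler0c.
- rewrite -RtoCX ler_RtoC; nra.
Qed.

(* Both sides are bounded functionals of f that agree on every basis vector. *)
Lemma cint_ev_psi (l : nat) (f : H) : 0 < sigma l ->
  cint (fun x => ev f x * (psi l x)^*) = RtoC (sigma l) * dot f (e l).
Proof.
move=> sl; have cpsi := continuous_conj_comp (continuous_psi sl).
pose D h := cint (fun x => ev h x * (psi l x)^*) - RtoC (sigma l) * dot h (e l).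
have Dlin a u v : D (a *: u + v) = a * D u + D v.
  rewrite /D linearDl linearZl_LR /= (_ : (fun x => _) =
    (fun x => a * (ev u x * (psi l x)^*) + ev v x * (psi l x)^*)); last first.
    by apply/funext => x; rewrite ev_scaleD mulrDl mulrA.
  have c1 h := continuous_mul (@cev h) cpsi.
  have c2 := @continuous_scale Omega (complexField R) a _ (c1 u).
  by rewrite (cintD mu cptO c2 (c1 v)) (cintZ mu cptO a (c1 u)); ring.
have D0 : D 0 = 0.
  have := Dlin 1 0 0; rewrite scale1r addr0 mul1r => /esym/eqP.
  by rewrite -subr_eq0 addrK => /eqP.
have De j : D (e j) = 0.
  have [sj|/basis_eq0-> //] := boolP (0 < sigma j).
  rewrite /D eON // (_ : (fun x => _) =
    (fun x => RtoC (sigma j) * (psi j x * (psi l x)^*))); last first.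
    by apply/funext => x; rewrite eE mulrA.
  rewrite (cintZ mu cptO _ (continuous_mul (continuous_psi sj) cpsi)).
  rewrite (mercer_orthonormal mercer) //.
  by case: eqP => [->|_]; rewrite ?mulr0 subrr.
have Ds m : D (series (fun j => dot f (e j) *: e j) m) = 0.
  elim: m => [|m IH]; first by rewrite /series /= big_geq.
  by rewrite seriesEord /= big_ord_recr /= addrC Dlin De mulr0 add0r -IH seriesEord.
have [B HB] := continuous_cmod_bounded cpsi.
have [K K0 HK] := ev_cmod_bounded.
have dB (h : H) (r : R) : `|h| <= RtoC r ->
    cmod (D h) <= r * (2 * (K * B) + sigma l).
  move=> hr.
  have r0 : 0 <= r by rewrite -ler_RtoC; exact: le_trans (normr_ge0 h) hr.
  have b1 := cint_mul_bound mu cptO (@cev h) cpsi (HK h r hr) HB.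
  have b2 : cmod (dot h (e l)) <= r.
    rewrite -(ler_pXn2r (n := 2)) ?nnegrE ?cmod_ge0 //.
    rewrite -ler_RtoC !RtoCX; apply: le_trans (cauchy_schwarz dot h (e l)) _.
    rewrite eON // eqxx mulr1 dot_norm lerXn2r // nnegrE ?normr_ge0 //.
    by rewrite ler0c.
  have b3 : cmod (RtoC (sigma l) * dot h (e l)) <= sigma l * r.
    rewrite cmodM (_ : cmod (RtoC (sigma l)) = sigma l) ?ler_wpM2l // ?ltW //.
    by rewrite /cmod /= expr0n addr0 sqrtr_sqr gtr0_norm.
  rewrite /D; apply: le_trans (le_normcD _ _) _.
  rewrite normcN; apply: le_trans (lerD b1 b3) _.
  by rewrite mulrDr [_ * sigma l]mulrC lerD2r; lra.
suff /eqP : D f = 0 by rewrite subr_eq0 => /eqP.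
apply: contrapT => /eqP Df0.
have d0 : 0 < cmod (D f).
  by rewrite -ltcR -[(cmod _)%:C%C]/(RtoC _) RtoC_cmod normr_gt0.
(* [C] is positive and strictly exceeds the bound of [D] from [dB]. A partial sum within
   [cmod (D f) / C] of [f] then gives [cmod (D f) < cmod (D f)], because [D] vanishes on partial
   sums. *)
pose C : R := `|2 * (K * B) + sigma l| + 1.
have C0 : 0 < C by rewrite ltr_wpDl.
have eps0 : 0 < RtoC (cmod (D f) / C) by rewrite ltcR divr_gt0.
have /(@cvgrPdist_lt _ _ _ _ eventually_filter)/(_ _ eps0)
  [m _ /(_ m (leqnn m))/=] := @eB f.
set s := series _ m => /ltW fs.
have := dB _ _ fs.
have -> : D (f - s) = D f.
  by rewrite addrC -scaleN1r Dlin Ds mulr0 add0r.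
apply/negP; rewrite -ltNge mulrAC ltr_pdivrMr // ltr_pM2l // /C.
by apply: le_lt_trans (ler_norm _) _; rewrite ltrDl.
Qed.

Definition basis_projection (f : H) : H := \sum_(j < n) dot f (e j) *: e j.

Lemma dot_projection_residual f (l : 'I_n) : dot (f - basis_projection f) (e l) = 0.
Proof.
rewrite linearBl /= dot_suml (bigD1 l) //= big1 => [|j jl].
  by rewrite linearZl_LR /= eON_ord eqxx mulr1 addr0 subrr.
by rewrite linearZl_LR /= eON_ord (negbTE jl) mulr0.
Qed.

Lemma ev_projection f x :
  ev (basis_projection f) x = \sum_(j < n) dot f (e j) * (RtoC (sigma j) * psi j x).
Proof.
by rewrite evE dot_suml; apply: eq_bigr => j _; rewrite linearZl_LR /= dot_e_kv.
Qed.

(** The projection is self-adjoint, so it can be moved from [f] to the kernel vector. *)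
Lemma ev_projection_residual f x :
  ev (f - basis_projection f) x = dot f (kernel_residual x).
Proof.
rewrite linearB /= -[LHS]/(ev f x - ev (basis_projection f) x) evE ev_projection.
rewrite linearBr /= dot_sumr; congr (_ - _); apply: eq_bigr => j _.
by rewrite -dot_e_kv (dot_conj dot (kv x) (e j)) [RHS]linearZr_LR /= mulrC.
Qed.

Lemma projection_residual_bound f x : dot f f <= 1 ->
  cmod (ev (f - basis_projection f) x) ^+ 2 <= residual_diag x.
Proof.
move=> f1; rewrite -ler_RtoC RtoCX RtoC_cmod ev_projection_residual.
apply: le_trans (cauchy_schwarz _ _ _) _.
by rewrite sqnorm_kernel_residual ler_piMl // ler0c residual_diag_ge0.
Qed.

(** Parseval's identity in L_2. The length [m] is independent of [n] because the lower bound applies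
    it to longer sections of the basis. *)
Lemma cint_sqnorm_psi_sum (m : nat) (c : 'I_m -> complexField R) :
  (forall j : 'I_m, 0 < sigma j) ->
  cint (fun x => (\sum_(j < m) c j * psi j x) * (\sum_(j < m) c j * psi j x)^*)
    = RtoC (\sum_(j < m) cmod (c j) ^+ 2).
Proof.
move=> sm; have cp (j : 'I_m) := continuous_psi (sm j).
have cpp (j l : 'I_m) : continuous (fun x => psi j x * (psi l x)^*).
  exact (continuous_mul (cp j) (continuous_conj_comp (cp l))).
rewrite (_ : (fun x => _) = (fun x =>
  \sum_(j < m) \sum_(l < m) (c j * (c l)^*) * (psi j x * (psi l x)^*))); last first.
  apply/funext => x; rewrite mulr_suml; apply: eq_bigr => j _.
  rewrite rmorph_sum mulr_sumr; apply: eq_bigr => l _.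
  by rewrite rmorphM /= mulrACA.
have ct (j l : 'I_m) : continuous (fun x => (c j * (c l)^*) * (psi j x * (psi l x)^*)).
  exact (continuous_scale (cpp j l)).
rewrite (cint_sum mu cptO) => [|j _]; last first.
  by apply: continuous_sum => l _; exact: ct.
rewrite RtoC_sum; apply: eq_bigr => j _.
rewrite (cint_sum mu cptO) => [|l _]; last exact: ct.
rewrite (bigD1 j) //= big1 => [|l lj].
  by rewrite addr0 (cintZ mu cptO _ (cpp j j)) (mercer_orthonormal mercer) //
     eqxx mulr1 RtoC_cmod_sqr.
rewrite (cintZ mu cptO _ (cpp j l)) (mercer_orthonormal mercer) //.
by rewrite (_ : (j == l :> nat) = false) ?mulr0 //; rewrite eq_sym; exact/negbTE.
Qed.

Lemma sqnormL2_pythagoras (g : Omega -> complexField R) (c : 'I_n -> complexField R) :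
  continuous g -> (forall j : 'I_n, cint (fun x => g x * (psi j x)^*) = 0) ->
  sqnormL2 mu (fun x => g x - \sum_(j < n) c j * psi j x)
    = (rint (fun x => cmod (g x) ^+ 2) + \sum_(j < n) cmod (c j) ^+ 2)%:E.
Proof.
move=> cg g0; have cp (j : 'I_n) := continuous_psi (sigma_ord j).
pose s x := \sum_(j < n) c j * psi j x.
have cs : continuous s.
  by apply: continuous_sum => j _; exact (continuous_scale (cp j)).
have csc := continuous_conj_comp cs.
have gs0 : cint (fun x => g x * (s x)^*) = 0.
  rewrite (_ : (fun x => _) = (fun x =>
    \sum_(j < n) (c j)^* * (g x * (psi j x)^*))); last first.
    apply/funext => x; rewrite rmorph_sum mulr_sumr; apply: eq_bigr => j _.
    by rewrite rmorphM /= mulrCA.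
  have ct (j : 'I_n) := continuous_mul cg (continuous_conj_comp (cp j)).
  rewrite (cint_sum mu cptO) => [|j _]; last exact (continuous_scale (ct j)).
  by rewrite big1 // => j _; rewrite (cintZ mu cptO _ (ct j)) g0 mulr0.
rewrite (sqnormL2_cint mu cptO (continuous_add cg (continuous_opp cs))).
have cgg := continuous_mul cg (continuous_conj_comp cg).
have css := continuous_mul cs csc.
have cgs := continuous_mul cg csc.
have cc := continuous_scale (c := -1) (continuous_add cgs (continuous_conj_comp cgs)).
rewrite (_ : (fun x => (g x - _) * _) = (fun x => g x * (g x)^* + s x * (s x)^*
   + -1 * (g x * (s x)^* + (g x * (s x)^*)^*))); last first.
  apply/funext => x; rewrite -/(s x) rmorphB rmorphM /= conjCK.
  by ring.
rewrite (cintD mu cptO (continuous_add cgg css) cc) (cintD mu cptO cgg css).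
rewrite (cintZ mu cptO _ (continuous_add cgs (continuous_conj_comp cgs))).
rewrite (cintD mu cptO cgs (continuous_conj_comp cgs)) (cint_conj mu cptO cgs).
rewrite gs0 rmorph0 addr0 mulr0 addr0 ReD (cint_sqnorm_psi_sum _ sigma_ord) /=.
by congr (_ + _)%:E; congr rint; apply/funext => x; rewrite cmod_sqr.
Qed.

(** * Upper bound for the error of the recovery operator *)

Section Recovery.
Variables (N : nat) (xs : 'I_N -> Omega) (lam : 'I_N -> R).
Hypothesis quad : quadrature sigma psi n xs lam.
Local Notation om := (omega sigma psi n).
Local Notation coef := (recovery_coef sigma psi n xs lam).

Lemma recovery_coefD f g j :
  coef (fun x => f x + g x) j = coef f j + coef g j.
Proof.
rewrite /recovery_coef -big_split; apply: eq_bigr => i _ /=.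
by rewrite mulrDr mulrDl.
Qed.

Lemma recovery_coefZ a f j : coef (fun x => a * f x) j = a * coef f j.
Proof.
rewrite /recovery_coef mulr_sumr; apply: eq_bigr => i _.
by rewrite !mulrA [_ * a]mulrC !mulrA.
Qed.

(** This is the quadrature condition for the pair [(l, j)]: the operator reproduces each of the
    first [n] eigenfunctions. *)
Lemma recovery_coef_psi (l j : 'I_n) : coef (psi l) j = (l == j)%:R.
Proof.
have [_ _ <-] := quad; apply: eq_bigr => i _.
by rewrite -!mulrA; congr (_ * _); rewrite mulrC mulrA.
Qed.

Lemma recovery_coef_sum (c : 'I_n -> complexField R) (j : 'I_n) :
  coef (fun x => \sum_(l < n) c l * psi l x) j = c j.
Proof.
transitivity (\sum_(l < n) c l * coef (psi l) j); last first.
  rewrite (bigD1 j) //= big1 => [|l lj]; rewrite recovery_coef_psi.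
    by rewrite eqxx mulr1 addr0.
  by rewrite (negbTE lj) mulr0.
rewrite /recovery_coef; under [RHS]eq_bigr do rewrite mulr_sumr.
rewrite exchange_big /=; apply: eq_bigr => i _.
rewrite mulr_sumr mulr_suml; apply: eq_bigr => l _; ring.
Qed.

(** Map a function [h] to the vector of [C^N] with entries [sqrt (lam i / om (xs i)) * h (xs i)].
    The quadrature makes the images of the [psi j] orthonormal, and the coefficients of [g] are its
    inner products with them. *)
Lemma recovery_coef_bessel (g : Omega -> complexField R) :
  \sum_(j < n) cmod (coef g j) ^+ 2
    <= \sum_(i < N) lam i / om (xs i) * cmod (g (xs i)) ^+ 2.
Proof.
have [l0 _ q] := quad.
pose r i : R := Num.sqrt (lam i / om (xs i)).
have rr i : RtoC (r i) * RtoC (r i) = RtoC (lam i) / RtoC (om (xs i)).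
  rewrite -RtoCM -expr2 sqr_sqrtr ?RtoCM ?RtoCV //.
  by rewrite divr_ge0 // ltW // omega_gt0.
pose vec (h : Omega -> complexField R) : 'rV[complexField R]_N :=
  \row_i (RtoC (r i) * h (xs i)).
have dotE h h' : dotmx (vec h) (vec h') =
    \sum_i RtoC (lam i) / RtoC (om (xs i)) * (h (xs i) * (h' (xs i))^*).
  rewrite dotmxE mxE; apply: eq_bigr => i _.
  by rewrite !mxE rmorphM /= conjC_RtoC mulrACA rr.
have ON (j l : 'I_n) : dotmx (vec (psi j)) (vec (psi l)) = (j == l)%:R.
  by rewrite dotE -q; apply: eq_bigr => i _; rewrite mulrAC !mulrA.
have : \sum_(j < n) `|dotmx (vec g) (vec (psi j))| ^+ 2 <= dotmx (vec g) (vec g).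
  exact: bessel (vec g) ON.
rewrite dotE -ler_RtoC; congr (is_true (_ <= _)).
  rewrite RtoC_sum; apply: eq_bigr => j _; rewrite dotE RtoCX.
  rewrite RtoC_cmod; congr (_ ^+ 2); congr (`|_|).
  by apply: eq_bigr => i _; rewrite mulrA.
rewrite RtoC_sum; apply: eq_bigr => i _.
by rewrite RtoCM RtoC_cmod_sqr RtoCM RtoCV.
Qed.

(** The operator is additive and fixes [basis_projection f], so only the residual contributes to the
    error. *)
Lemma recovery_residual f x :
  ev f x - recovery sigma psi n xs lam (ev f) x =
  ev (f - basis_projection f) x
    - \sum_(j < n) coef (ev (f - basis_projection f)) j * psi j x.
Proof.
set g := f - _.
have fE : ev f = (fun y => ev g y +
    \sum_(j < n) (dot f (e j) * RtoC (sigma j)) * psi j y).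
  apply/funext => y; have -> : f = g + basis_projection f by rewrite subrK.
  rewrite {1}linearD /= -[LHS]/(ev g y + _) ev_projection subrK.
  by congr (_ + _); apply: eq_bigr => j _; rewrite mulrA.
rewrite /recovery {1}fE -addrA; congr (_ + _).
under [X in _ - X]eq_bigr do rewrite fE recovery_coefD recovery_coef_sum mulrDl.
by rewrite big_split /=; ring.
Qed.

Lemma recovery_error (f : H) : `|f| <= 1 ->
  (sqnormL2 mu (fun x => ev f x - recovery sigma psi n xs lam (ev f) x)%R
    <= 3%:E * tail_sum sigma n)%E.
Proof.
move=> f1; have ff1 : dot f f <= 1 by rewrite dot_norm expr_le1.
under [X in sqnormL2 _ X]eq_fun do rewrite recovery_residual.
set g := f - _.
(* Orthogonality in [H] passes to orthogonality in L_2. *)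
have g0 (j : 'I_n) : cint (fun x => ev g x * (psi j x)^*) = 0.
  by rewrite cint_ev_psi // dot_projection_residual mulr0.
rewrite (sqnormL2_pythagoras _ (@cev g) g0) tail_sumE -EFinM lee_fin.
have gr x : cmod (ev g x) ^+ 2 <= residual_diag x.
  exact: projection_residual_bound.
have p1 : rint (fun x => cmod (ev g x) ^+ 2) <= tail_real.
  rewrite -rint_residual_diag; apply: (le_rint mu cptO) gr.
    exact (continuous_cmod_sqr (@cev g)).
  exact: continuous_residual_diag.
(* At each node [cmod (ev g x) ^+ 2 / om x] is at most [2 * tail_real], and the weights sum to 1. *)
have p2 : \sum_(j < n) cmod (coef (ev g) j) ^+ 2 <= 2 * tail_real.
  apply: le_trans (recovery_coef_bessel _) _; have [l0 l1 _] := quad.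
  have -> : 2 * tail_real = \sum_(i < N) 2 * tail_real * lam i.
    by rewrite -mulr_sumr l1 mulr1.
  apply: ler_sum => i _.
  have o0 := omega_gt0 (xs i).
  rewrite mulrAC ler_pdivrMr // [_ * lam i]mulrC -mulrA ler_wpM2l //.
  exact: le_trans (gr _) (residual_diag_le_omega _).
by move: p1 p2; lra.
Qed.

End Recovery.

(** * Lower bound for the Gelfand numbers *)

(** [A] is the matrix of [L] on the first [m] basis vectors; its rank is at most [n], so its left
    kernel has dimension at least [m - n]. Gram-Schmidt turns a basis of that kernel into
    orthonormal rows with the same span. *)
Let kernel_orthonormal_rows (m : nat) (L : {linear H -> 'cV[complexField R]_n}) :
  (forall j : 'I_m, 0 < sigma j) ->
  exists (p : nat) (U : 'M[complexField R]_(p, m)),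
    [/\ (m - n <= p)%N, U \is unitarymx &
        forall i, L (\sum_j U i j *: e j) = 0].
Proof.
move=> sm; pose A : 'M[complexField R]_(m, n) := \matrix_(j, i) L (e j) i 0.
pose K := row_base (kermx A).
exists _, (schmidt K); split.
- by rewrite mxrank_ker leq_sub2l // rank_leq_col.
- exact/schmidt_unitarymx/rank_leq_col.
- have UA : schmidt K *m A = 0.
    by apply/sub_kermxP; rewrite (eqmx_schmidt_free (row_base_free _)) eq_row_base.
  move=> i; rewrite linear_sum; apply/colP => l; rewrite summxE mxE.
  have /matrixP/(_ i l) := UA; rewrite !mxE => {2}<-.
  by apply: eq_bigr => j _; rewrite linearZ !mxE.
Qed.

Lemma kernel_section_bound (m : nat) (L : {linear H -> 'cV[complexField R]_n}) (c : R) :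
  (forall j : 'I_m, 0 < sigma j) -> 0 <= c ->
  (forall f : H, `|f| <= 1 -> L f = 0 -> forall x, cmod (ev f x) <= c) ->
  \sum_(j < m | (n <= j)%N) sigma j ^+ 2 <= c ^+ 2.
Proof.
move=> sm c0 Lc; have [p [U [pm /row_unitarymxP Uu UL]]] := kernel_orthonormal_rows L sm.
pose u i := \sum_j U i j *: e j.
have UON i i' : \sum_j U i j * (U i' j)^* = (i == i')%:R.
  by rewrite -Uu dotmxE mxE; apply: eq_bigr => j _; rewrite !mxE.
have uON i i' : dot (u i) (u i') = (i == i')%:R.
  rewrite -UON dot_suml; apply: eq_bigr => j _; rewrite linearZl_LR /=.
  congr (_ * _); rewrite dot_sumr (bigD1 j) //= big1 => [|l lj].
    by rewrite linearZr_LR /= eON // eqxx mulr1 addr0.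
  rewrite linearZr_LR /= eON // (_ : (j == l :> nat) = false) ?mulr0 //.
  by rewrite eq_sym; exact/negbTE.
have evu i x : ev (u i) x = \sum_j (U i j * RtoC (sigma j)) * psi j x.
  rewrite evE dot_suml; apply: eq_bigr => j _.
  by rewrite linearZl_LR /= dot_e_kv mulrA.
have Bc x : \sum_i cmod (ev (u i) x) ^+ 2 <= c ^+ 2.
  set B := \sum_i _.
  have B0 : 0 <= B by apply: sumr_ge0 => i _; exact: sqr_ge0.
  move: (B0); rewrite le_eqVlt => /predU1P[<-|Bgt0]; first exact: sqr_ge0.
  (* The normalised f maximises the value at x on the unit ball of span u. *)
  pose f := \sum_i (ev (u i) x)^* *: u i.
  have ff : dot f f = RtoC B.
    rewrite /f dot_suml RtoC_sum; apply: eq_bigr => i _.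
    rewrite linearZl_LR /= dot_sumr (bigD1 i) //= big1 => [|l li].
      by rewrite linearZr_LR /= uON eqxx mulr1 addr0 conjCK RtoC_cmod_sqr mulrC.
    by rewrite linearZr_LR /= uON eq_sym (negbTE li) mulr0.
  have fx : ev f x = RtoC B.
    rewrite evE dot_suml RtoC_sum; apply: eq_bigr => i _.
    by rewrite linearZl_LR /= -evE RtoC_cmod_sqr mulrC.
  pose r := Num.sqrt B; have r0 : 0 < r by rewrite sqrtr_gt0.
  have rB : r ^+ 2 = B by rewrite sqr_sqrtr.
  have n1 : `|RtoC r^-1 *: f| <= 1.
    rewrite -(@expr_le1 _ 2) // -dot_norm dnormZ ff -rB.
    rewrite ger0_norm ?ler0c ?invr_ge0 ?(ltW r0) //.
    by rewrite -RtoCX -RtoCM -exprMn mulVf ?gt_eqF // expr1n.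
  have Lf : L (RtoC r^-1 *: f) = 0.
    rewrite linearZ /= linear_sum big1 => [|i _]; first by rewrite scaler0.
    by rewrite linearZ /= UL scaler0.
  have evZ : ev (RtoC r^-1 *: f) x = RtoC r^-1 * ev f x.
    by rewrite !evE; exact: linearZl_LR.
  have := Lc _ n1 Lf x.
  rewrite evZ fx -RtoCM -rB expr2 mulKf ?gt_eqF // => rc.
  rewrite -expr2 lerXn2r ?nnegrE ?(ltW r0) //; apply: le_trans rc.
  by rewrite /cmod /= expr0n addr0 sqrtr_sqr ler_norm.
have cu i : continuous (fun x => cmod (ev (u i) x) ^+ 2).
  exact (continuous_cmod_sqr (@cev (u i))).
(* [w j] is the squared norm of the projection of [e j] onto the span of the [u i]: a diagonal entry
   of a projection matrix of rank [p]. Hence it lies between 0 and 1, and the [w j] sum to [p], as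
   [sum_tail_le_weighted] requires. *)
pose w (j : 'I_m) := \sum_i cmod (U i j) ^+ 2.
have int_u i : rint (fun x => cmod (ev (u i) x) ^+ 2)
    = \sum_(j < m) sigma j ^+ 2 * cmod (U i j) ^+ 2.
  have cS := cint_sqnorm_psi_sum (fun j : 'I_m => U i j * RtoC (sigma j)) sm.
  transitivity (complex.Re (cint (fun x => ev (u i) x * (ev (u i) x)^*))).
    by rewrite Re_cint; congr rint; apply/funext => x; rewrite cmod_sqr.
  under eq_fun do rewrite evu.
  rewrite cS; apply: eq_bigr => j _; rewrite cmodM exprMn mulrC; congr (_ * _).
  by rewrite cmod_sqrE /= expr0n addr0.
have swc : \sum_(j < m) sigma j ^+ 2 * w j <= c ^+ 2.
  have -> : \sum_(j < m) sigma j ^+ 2 * w j =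
      rint (fun x => \sum_i cmod (ev (u i) x) ^+ 2).
    rewrite (rint_sum mu cptO) //; under [RHS]eq_bigr do rewrite int_u.
    by rewrite exchange_big /=; apply: eq_bigr => j _; rewrite mulr_sumr.
  rewrite -(rint_cst mu (c ^+ 2)); apply: (le_rint mu cptO) => //.
    exact: continuous_sum.
  exact: continuous_const.
apply: le_trans swc.
apply: (@sum_tail_le_weighted _ _ _ (fun j => sigma j ^+ 2)).
- move=> i j ij; rewrite lerXn2r ?nnegrE ?(mercer_ge0 mercer) //.
  exact: (mercer_nonincreasing mercer).
- exact: sqr_ge0.
- move=> j; apply/andP; split; first by apply: sumr_ge0 => i _; exact: sqr_ge0.
  have ON i i' : dotmx (row i U) (row i' U) = (i == i')%:R by rewrite Uu.
  (* Bessel's inequality for a standard basis vector against the rows of [U] gives [w j <= 1]. *)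
  have : \sum_i `|dotmx ('e_j : 'rV[complexField R]_m) (row i U)| ^+ 2
      <= dotmx ('e_j : 'rV[complexField R]_m) 'e_j by exact: bessel ON.
  have dE (v : 'rV[complexField R]_m) : dotmx 'e_j v = (v 0 j)^*.
    rewrite dotmxE mxE (bigD1 j) //= big1 => [|l lj].
      by rewrite !mxE !eqxx mul1r addr0.
    by rewrite !mxE (negbTE lj) andbF mul0r.
  rewrite dE mxE !eqxx rmorph1 -[1]/(RtoC 1) -ler_RtoC; congr (is_true (_ <= _)).
  rewrite RtoC_sum; apply: eq_bigr => i _.
  by rewrite dE norm_conjC mxE RtoCX.
- have -> : \sum_j w j = p%:R.
    rewrite exchange_big /= (eq_bigr (fun=> 1)) ?sumr_const ?card_ord // => i _.
    have := UON i i; rewrite eqxx => /(congr1 (fun z : complexField R => complex.Re z)).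
    by rewrite Re_sum /= => <-; apply: eq_bigr => j _; rewrite cmod_sqr.
  by rewrite ler_nat.
Qed.

(** The partial sums are bounded one by one. If [sigma m] is positive, so are all earlier ones and
    [kernel_section_bound] applies to the section of length [m.+1]; otherwise the new term is
    zero. *)
Lemma tail_le_sq (L : {linear H -> 'cV[complexField R]_n}) (c : R) :
  0 <= c ->
  (forall f : H, `|f| <= 1 -> L f = 0 -> forall x, cmod (ev f x) <= c) ->
  tail_real <= c ^+ 2.
Proof.
move=> c0 Lc.
have part m : \sum_(j < m | (n <= j)%N) sigma j ^+ 2 <= c ^+ 2.
  elim: m => [|m IH]; first by rewrite big_ord0 sqr_ge0.
  have [sm|sm] := boolP (0 < sigma m).
    apply: kernel_section_bound c0 Lc => j; apply: lt_le_trans sm _.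
    by apply: (mercer_nonincreasing mercer); rewrite -ltnS.
  rewrite big_mkcond big_ord_recr -big_mkcond /=.
  have -> : sigma m = 0.
    by apply/eqP; rewrite eq_le (mercer_ge0 mercer) andbT leNgt.
  by rewrite expr0n /= if_same addr0.
rewrite -lee_fin -tail_sumE; apply: lime_le.
  by apply: is_cvg_nneseries => j _ _; rewrite lee_fin sqr_ge0.
apply: nearW => m; rewrite sumEFin lee_fin; apply: le_trans (part m).
by rewrite (@big_nat_widenl _ _ _ n 0%N) // big_mkord.
Qed.

(* An algorithm sees the same information on f and on - f when L f = 0. *)
Lemma tail_le_gelfand_sq : (tail_sum sigma n <= gelfand_number ev n ^+ 2)%E.
Proof.
have t0 := ltW tail_real_gt0.
have lb : ((Num.sqrt tail_real)%:E <= gelfand_number ev n)%E.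
  apply: le_ereal_inf_tmp => _ [theta [L [_ _ ->]]].
  set s := ereal_sup _.
  have s_ub (f : H) x : `|f| <= 1 -> ((cmod (ev f x - theta (L f) x))%:E <= s)%E.
    move=> f1; apply: (@le_trans _ _ (supnorm (fun x => ev f x - theta (L f) x))).
      by apply: ereal_sup_ubound; exists x.
    by apply: ereal_sup_ubound; exists f.
  (* An infinite error bounds anything from above; the value minus infinity is excluded by the error
     of the zero function at [point]. *)
  case: s s_ub => [c||] s_ub; last 2 first.
  - exact: leey.
  - by have := s_ub 0 point; rewrite normr0 => /(_ ler01).
  have c0 : 0 <= c.
    have := s_ub 0 point; rewrite normr0 lee_fin => /(_ ler01).
    exact: le_trans (cmod_ge0 _).
  rewrite lee_fin -(ger0_norm c0) -sqrtr_sqr ler_wsqrtr //.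
  apply: (@tail_le_sq L) => // f f1 Lf x.
  have := s_ub f x f1; rewrite lee_fin Lf => h1.
  have := s_ub (- f) x; rewrite normrN => /(_ f1).
  have -> : ev (- f) x = - ev f x by rewrite !evE linearNl.
  rewrite lee_fin linearN Lf oppr0 => h2.
  have hs : cmod (2 * ev f x) <= 2 * c.
    have -> : 2 * ev f x = (ev f x - theta 0 x) - (- ev f x - theta 0 x) by ring.
    apply: le_trans (le_normcD _ _) _; rewrite normcN -/(cmod _).
    by have := lerD h1 h2; rewrite mulr2n mulrDl mul1r.
  move: hs; rewrite (_ : 2 * ev f x = RtoC 2 * ev f x); last first.
    by congr (_ * _); apply: eq_complexP; rewrite /= ?addr0.
  rewrite cmodM (_ : cmod (RtoC 2) = 2); last first.
    by rewrite /cmod /= expr0n addr0 sqrtr_sqr ger0_norm.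
  by rewrite ler_pM2l.
move: lb; case: (gelfand_number ev n) => [c||] //; rewrite ?expe2 => lb.
- move: lb; rewrite lee_fin => lb;
  rewrite tail_sumE -EFinM lee_fin -expr2 -(sqr_sqrtr t0).
  by rewrite lerXn2r ?nnegrE ?sqrtr_ge0 // (le_trans _ lb) ?sqrtr_ge0.
- by rewrite mulyy leey.
Qed.

End MercerKernel.

(** * Operation count of the recovery formula *)

Section ArithmeticCost.
Implicit Types n N : nat.

Lemma arith_eval_sum (K : numClosedFieldType) (V : Type) (env : V -> K) N
    (F : 'I_N -> arith V) :
  arith_eval env (\big[@AAdd V/AZero]_(i < N) F i)
    = \sum_(i < N) arith_eval env (F i).
Proof. exact: (big_morph (arith_eval env)). Qed.

(** Each summand costs one further addition, since the big operator also adds the final [AZero]. *)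
Lemma arith_ops_sum (V : Type) N (F : 'I_N -> arith V) (c : nat) :
  (forall i, arith_ops (F i) = c) ->
  arith_ops (\big[@AAdd V/AZero]_(i < N) F i) = (N * c.+1)%N.
Proof.
move=> Fc; elim: N F Fc => [|N IH] F Fc; first by rewrite big_ord0.
by rewrite big_ord_recl /= Fc IH // mulSn.
Qed.

Lemma arith_ops_recovery n N :
  arith_ops (recovery_formula n N) = (n * (N * 5 + 2))%N.
Proof.
rewrite /recovery_formula (arith_ops_sum (c := (N * 5).+1)) ?addn2 // => j /=.
(* Each node takes one division, two multiplications and one conjugation. *)
by rewrite (arith_ops_sum (c := 4)) // addn0.
Qed.

(** The count is at most [5 * n ^ 3 + 7 * n], hence at most [12 * n ^ 3]; the constant 13 makes the
    inequality strict for positive [n]. *)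
Lemma arith_ops_recovery_lt n N : (0 < n)%N -> (N <= n ^ 2 + 1)%N ->
  (arith_ops (recovery_formula n N) < 13 * n ^ 3)%N.
Proof. by rewrite arith_ops_recovery => n0 Nn; nia. Qed.

End ArithmeticCost.

Theorem theorem7p1 (R : realType) :
  exists c : R, 0 < c /\
  forall (Omega : ptopologicalType) (mu : probability (borelType Omega) R)
         (k : Omega -> Omega -> complexField R)
         (sigma : nat -> R) (psi : nat -> Omega -> complexField R)
         (H : completeNormedModType (complexField R))
         (dot : {dot H for @Num.conj (complexField R)})
         (ev : {linear H -> (Omega -> complexField R)})
         (n : nat),
    compact [set: Omega] ->
    is_mercer mu k sigma psi ->
    is_rkhs dot ev k ->
    mercer_basis sigma psi dot ev ->
    lt_dim H n ->
    (exists (N : nat) (xs : 'I_N -> Omega) (lam : 'I_N -> R),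
       (N <= n ^ 2 + 1)%N /\ quadrature sigma psi n xs lam) /\
    (forall (N : nat) (xs : 'I_N -> Omega) (lam : 'I_N -> R),
       (N <= n ^ 2 + 1)%N -> quadrature sigma psi n xs lam ->
       let S := recovery sigma psi n xs lam in
       [/\ (linear (fun f : H => S (ev f)) /\
            forall f : H, inL2 mu (ev f) /\ inL2 mu (S (ev f))),
           (sq_worst_case_error mu ev (fun f => S (ev f))
            <= 3%:E * tail_sum sigma n)%E,
           (3%:E * tail_sum sigma n <= 3%:E * gelfand_number ev n ^+ 2)%E,
           (forall (f : H) (x : Omega),
              arith_eval (recovery_data sigma psi xs lam (ev f) x)
                   (recovery_formula n N) = S (ev f) x) &
           (0 < n)%N -> (arith_ops (recovery_formula n N))%:R < c * n%:R ^+ 3]).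
Proof.
exists 13; split=> // Omega mu k sigma psi H dot ev n cptO mercer rkhs
  [e [eE eON eB]] dimH.
have [dot_norm ev_inj repr] := rkhs.
have [kv kvP] := choice repr.
have kvE y : ev (kv y) = (fun x => k x y) by have [] := kvP y.
have evE f y : ev f y = dot f (kv y) by have [_] := kvP y; apply.
(* The dimension hypothesis enters here: some [e j] with [n <= j] is nonzero, so [sigma j] is
   positive, and [sigma] is nonincreasing. *)
have sn : 0 < sigma n.
  have [j nj ej] := lt_dim_basis_neq0 eB dimH.
  have sj : 0 < sigma j.
    apply: contraNT ej => sj.
    by apply/eqP; exact: (basis_eq0 mercer eE ev_inj).
  by apply: lt_le_trans sj _; exact: (mercer_nonincreasing mercer).
have spos (j : 'I_n) : 0 < sigma j by exact: (sigma_gt0 mercer sn (ltnW (ltn_ord j))).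
have cpsi (j : 'I_n) : continuous (psi j).
  exact (continuous_psi mercer kvE evE eE (spos j)).
have om0 := omega_gt0 cptO mercer kvE evE eE eON sn.
split.
  have ON (j l : 'I_n) : cintegral mu (fun x => psi j x * (psi l x)^*) = (j == l)%:R.
    by rewrite (mercer_orthonormal mercer).
  have [N [xs [lam [Nn l0 l1 q]]]] := orthonormal_quadrature cptO cpsi ON
    (continuous_omega mercer kvE evE eE sn) om0
    (rint_omega cptO mercer kvE evE eE sn).
  by exists N, xs, lam.
move=> N xs lam Nn quad S; split.
- split=> [a f g|f].
    have -> : ev (a *: f + g) = (fun y => a * ev f y + ev g y).
      by apply/funext => y; rewrite linearP.
    apply/funext => x; rewrite -[RHS]/(a * S (ev f) x + S (ev g) x).
    rewrite /S /recovery mulr_sumr -big_split; apply: eq_bigr => j _ /=.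
    by rewrite recovery_coefD recovery_coefZ mulrDl mulrA.
  split; apply: (continuous_inL2 mu cptO).
    exact (@continuous_ev _ _ k _ dot ev kv kvE evE (mercer_continuous mercer) f).
  apply: continuous_sum => j _; exact (continuous_scale (cpsi j)).
- apply: ge_ereal_sup => _ [f f1 <-].
  exact: (recovery_error cptO mercer kvE evE eE eON sn ev_inj dot_norm eB quad).
- apply: lee_wpmul2l => //.
  exact: (tail_le_gelfand_sq cptO mercer kvE evE eE eON sn dot_norm).
- move=> f x; rewrite arith_eval_sum; apply: eq_bigr => j _ /=.
  by rewrite arith_eval_sum.
- move=> n0; rewrite -natrX -natrM ltr_nat.
  exact: arith_ops_recovery_lt.
Qed.
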